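(* Let $p$ be an odd prime and let $G=H_{p^3}=\operatorname{UT}_3(\mathbb F_p)$ be the Heisenberg group over $\mathbb F_p$. Then $$E(G)=\mathsf d(G)+|G|=p^3+3p-3.$$
   Context: The Heisenberg group $H_{p^3}=\operatorname{UT}_3(\mathbb F_p)$ is the group, under matrix multiplication, of all upper triangular $3\times 3$ matrices over the field $\mathbb F_p$ with $p$ elements having all diagonal entries equal to $1$; it has order $p^3$. Let $G$ be a finite group with identity $1$. A sequence over $G$ is a finite unordered list of elements of $G$ with repetition allowed (a finite multiset, i.e. an element of the free abelian monoid on $G$); its length is the number of terms counted with multiplicity, and a subsequence is a sub-multiset. A nonempty sequence is called product-one if its terms can be ordered so that their product in $G$ (in that order) equals $1$. A sequence is product-one free if it has no nonempty product-one subsequence. The small Davenport constant $\mathsf d(G)$ is the largest integer $\ell$ such that there exists a product-one free sequence over $G$ of length $\ell$. The Gao constant $E(G)$ is the least integer $\ell$ such that every sequence over $G$ of length at least $\ell$ contains a product-one subsequence of length exactly $|G|$. *)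

(* Defs.v *)
From mathcomp Require Import all_boot all_order all_algebra all_fingroup.
From mathcomp Require Import finmap multiset boolp.

Set Implicit Arguments.
Unset Strict Implicit.
Unset Printing Implicit Defensive.

Import GroupScope.

(* The entries on and below the diagonal are those of the identity matrix. *)
Definition UT3 (p : nat) : {set {'GL_3(p)}} :=
  [set g : {'GL_3(p)} |
    [forall i : 'I_3, forall j : 'I_3,
      (j <= i)%N ==> (GLval g i j == ((i == j)%:R)%R)]].

Lemma UT3_group_set (p : nat) : group_set (UT3 p).
Proof.
apply/group_setP; split=> [|g h].
  rewrite inE; apply/'forall_forallP => i j; apply/implyP => _.
  by rewrite GL_1E mxE.
rewrite !inE => /'forall_forallP gP /'forall_forallP hP.
apply/'forall_forallP => i j; apply/implyP => le_ji.
rewrite GL_MxE mxE (bigD1 i) //= big1 ?GRing.addr0 => [|k neq_ki].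
  rewrite (eqP (implyP (gP i i) (leqnn i))) eqxx GRing.mul1r.
  exact: (implyP (hP i j) le_ji).
have [lt_ki | le_ik] := ltnP k i.
  rewrite (eqP (implyP (gP i k) (ltnW lt_ki))).
  by rewrite eq_sym (negPf neq_ki) GRing.mul0r.
have le_jk := leq_trans le_ji le_ik.
rewrite (eqP (implyP (hP k j) le_jk)) [k == j](_ : _ = false) ?GRing.mulr0 //.
apply: contraNF neq_ki => /eqP eq_kj.
by apply/eqP/val_inj/eqP; rewrite /= eqn_leq le_ik eq_kj le_ji.
Qed.

Canonical UT3_group (p : nat) : {group {'GL_3(p)}} := Group (UT3_group_set p).

Section ZeroSum.

Local Open Scope mset_scope.

Variables (gT : finGroupType) (G : {group gT}).
Implicit Types (S T : {mset gT}) (l : nat).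

Definition sequence_over S : Prop := {subset enum_mset S <= G}.

Definition product_one S : Prop :=
  S <> mset0 /\
  exists2 t : seq gT, perm_eq t (enum_mset S) & \prod_(x <- t) x = 1.

Definition product_one_free S : Prop :=
  forall T, T `<=` S -> ~ product_one T.

Definition has_product_one_free l : Prop :=
  exists S, [/\ sequence_over S, size (enum_mset S) = l & product_one_free S].

Definition gao_property l : Prop :=
  forall S, sequence_over S -> (l <= size (enum_mset S))%N ->
  exists T, [/\ T `<=` S, product_one T & size (enum_mset T) = #|G|].

Lemma product_one_free_size S :
  sequence_over S -> product_one_free S -> (size (enum_mset S) <= #|G|)%N.
Proof.
move=> SG Sfree; set s := enum_mset S; rewrite leqNgt; apply/negP => ltGs.
pose P (i : 'I_(size s)) := \prod_(x <- take i s) x.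
have PG i : P i \in G.
  rewrite /P big_seq; apply: group_prod => x /mem_take; exact: SG.
have [i [j [lt_ij eqPij]]] : exists i j : 'I_(size s), (i < j)%N /\ P i = P j.
  have /injectivePn [i [j neq_ij eqPij]] : ~~ injectiveb P.
    apply: contraL ltGs => /injectiveP injP; rewrite -leqNgt.
    rewrite -[size s]card_ord -(card_codom injP); apply: subset_leq_card.
    by apply/subsetP => x /codomP [i ->].
  by case: (ltngtP i j) (neq_ij) => [lt_ij|lt_ji|/val_inj->];
    [exists i, j|exists j, i|rewrite eqxx].
pose t := drop i (take j s).
have tE : take j s = take i s ++ t.
  by rewrite -[LHS](cat_take_drop i) take_takel // ltnW.
have tn : size t = (j - i)%N.
  by rewrite size_drop size_takel // ltnW.
apply: (Sfree (seq_mset t)).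
  apply/msubsetP => x; rewrite mset_seqE -[S x]count_mem_mset.
  by rewrite -/s -(cat_take_drop j s) tE !count_cat addnAC leq_addl.
split=> [t0|].
  have := perm_size (perm_eq_seq_mset t).
  by rewrite t0 enum_mset0 tn /= => /esym/eqP; rewrite subn_eq0 leqNgt lt_ij.
exists t; first by rewrite perm_sym perm_eq_seq_mset.
apply: (mulgI (\prod_(x <- take i s) x)).
by rewrite mulg1 -big_cat -tE; apply/esym.
Qed.

Lemma small_davenport_ex : exists l, `[< has_product_one_free l >].
Proof.
exists 0%N; apply/asboolP; exists mset0; split=> [x||T].
- by rewrite enum_mset0.
- by rewrite enum_mset0.
- by rewrite msubset0 => /eqP -> [].
Qed.

Lemma small_davenport_ub l : `[< has_product_one_free l >] -> (l <= #|G|)%N.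
Proof. by move=> /asboolP [S [SG <-]]; apply: product_one_free_size. Qed.

Definition small_davenport : nat := ex_maxn small_davenport_ex small_davenport_ub.

Lemma gao_ex : exists l, `[< gao_property l >].
Proof.
exists (#|G| ^ 2)%N; apply/asboolP => S SG leS.
have [g gG leg] : exists2 g, g \in G & (#|G| <= S g)%N.
  apply: contrapT => noG.
  have ltG g : g \in G -> (S g <= #|G|.-1)%N.
    move=> gG; rewrite -ltnS prednK ?cardG_gt0 // ltnNge; apply/negP => leg.
    by apply: noG; exists g.
  have: (size (enum_mset S) <= #|G| * #|G|.-1)%N.
    have -> : size (enum_mset S) = (\sum_(g in G) S g)%N.
      under eq_bigr do rewrite -count_mem_mset.
      move: SG; rewrite /sequence_over; elim: (enum_mset S) => [|x s IHs] sG; first by rewrite big1.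
      rewrite /= big_split /= -IHs => [|y ys]; last by apply: sG; rewrite inE ys orbT.
      rewrite (bigD1 x) ?sG ?mem_head //= eqxx big1 ?addn0 // => y /andP[_].
      by rewrite eq_sym => /negPf ->.
    rewrite -sum_nat_const; exact: leq_sum.
  rewrite leqNgt => /negP; apply; apply: leq_trans leS.
  by rewrite -mulnn ltn_pmul2l ?cardG_gt0 // prednK ?cardG_gt0.
exists (msetn #|G| g); rewrite enum_msetn size_nseq; split=> //.
  by apply/msubsetP => x; rewrite msetnE; case: eqP => // ->.
split=> [/(congr1 (fun T : {mset gT} => T g))|].
  by rewrite msetnxx mset0E => /eqP; rewrite eqn0Ngt cardG_gt0.
exists (nseq #|G| g); first by rewrite enum_msetn.
have /dvdnP [k ->] : (#[g] %| #|G|)%N by rewrite cardSg ?cycle_subG.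
by rewrite big_nseq -Monoid.iteropE -/(g ^+ (k * #[g])) mulnC expgM expg_order expg1n.
Qed.

Definition gao : nat := ex_minn gao_ex.

End ZeroSum.

(* Main.v *)
Require Import Defs.
From mathcomp Require Import all_boot all_order all_algebra all_fingroup.
From mathcomp Require Import cyclic finfield ring zify.
From mathcomp Require Import finmap multiset boolp.

Set Implicit Arguments.
Unset Strict Implicit.
Unset Printing Implicit Defensive.

Import GRing.Theory.

(** Write an element of the Heisenberg group as a vector [v = (cx, cy)] of the
    plane over the field with [p] elements together with a central coordinate
    [cz], normalised so that [cz (g * h) = cz g + cz h + omega g h] with
    [omega] the determinant of the two vectors. Reordering a sequence leaves
    the sum of its vectors unchanged and affects only the central coordinate
    of the product, through the values of [omega]. Call a sequence zero-sum
    when its vectors add up to zero; it is commuting when all its vectors lie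
    on one line, and then its product has as central coordinate just the sum
    of the [cz].

    Two mechanisms produce product-one subsequences. The first is Olson's
    theorem and its refinement with prescribed length ([zero_sum_exists],
    [zero_sum_exists_length]): in an elementary abelian group of rank [k] a
    sequence of more than [k * (p - 1)] terms has a nonempty zero-sum
    subsequence. Applied to the three coordinates it yields some [T] whose
    vectors and whose [cz] add up to zero; if [T] is commuting it is
    product-one. The second concerns noncommuting [T]. Moving one term from
    the front to the back of an ordering adds a nonzero constant to the
    central coordinate, so by a Cauchy-Davenport argument a noncommuting
    zero-sum sequence of [m] noncentral terms has at least [min p (m - 1)]
    ordered products ([products_zero_sum]). A long noncommuting zero-sum
    sequence therefore contains a product-one sequence.

    To prove that [3p - 2] terms always contain a product-one subsequence
    ([prod_one_exists]), suppose that they do not. Olson's theorem provides a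
    noncommuting zero-sum subsequence; take a longest one, [T], and let [U] be
    the rest. By maximality [U] has no nonempty zero-sum subsequence, so that it has at
    most [2p - 2] terms, and [T] has at most [p] terms by the second
    mechanism; hence both bounds are attained. Exchanging a term [x] of [T]
    for a part of [U] with the same sum cannot lengthen [T], so each such part
    is a single term, and the count modulo [p] behind Olson's theorem shows
    that [U] contains at least [p - 1] terms with the vector of [x]. As this
    holds for every noncentral term of [T], these have only two distinct
    vectors, which are independent, and then the zero sum of [T] requires at
    least [p] terms of each kind, although [T] has only [p] terms.

    For the Gao constant ([prod_one_gao]), a sequence of [p^3 + 3p - 3] terms
    has a subsequence [T] of length [p^3] on which all three coordinates sum
    to zero. It is product-one if it is commuting, and has an ordering with
    product one if it has more than [p] noncentral terms. Otherwise central
    terms predominate, and one central element [g] occurs at least [3p - 3]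
    times. Dividing all terms by [g] changes no product of [p^3] terms, and
    turns the copies of [g] into identities; the other terms are reduced to at
    most [3p - 3] by repeatedly removing product-one subsequences, and
    identities make up the length.

    Both bounds are sharp because of [p - 1] copies of each of three
    generators, the third one central, to which [p^3 - 1] identities are added
    for the Gao constant. *)

(** * Polynomial functions on subsets *)

Section Degree.

Local Open Scope ring_scope.

Variables (I : finType) (R : comNzRingType).
Implicit Types (A B C : {set I}) (f g : {set I} -> R).

(** The monomials in the indicator variables of the subset are the functions [A
    |-> (B \subset A)], of degree [#|B|]. *)
Definition deg_le (d : nat) f : Prop :=
  exists2 c : {set I} -> R, forall B, (d < #|B|)%N -> c B = 0
    & forall A, f A = \sum_(B : {set I} | B \subset A) c B.

Lemma eq_deg_le d f g : f =1 g -> deg_le d f -> deg_le d g.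
Proof. by move=> fg [c cd cE]; exists c => // A; rewrite -fg. Qed.

Lemma deg_leW d d' f : (d <= d')%N -> deg_le d f -> deg_le d' f.
Proof.
by move=> le_dd' [c cd cE]; exists c => // B /(leq_ltn_trans le_dd')/cd.
Qed.

Lemma deg_le_cst (x : R) : deg_le 0 (fun=> x).
Proof.
exists (fun B => if B == set0 then x else 0) => [B|A].
  by rewrite card_gt0 => /negPf ->.
rewrite -big_mkcondr /= (big_pred1 set0) // => B.
by rewrite /= andbC; case: eqP => // ->; rewrite sub0set.
Qed.

Lemma deg_le_sum (w : I -> R) : deg_le 1 (fun A => \sum_(i in A) w i).
Proof.
exists (fun B => \sum_i (if B == [set i] then w i else 0)) => [B ltB|A].
  by rewrite big1 // => i _; case: eqP ltB => // ->; rewrite cards1.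
rewrite exchange_big /= [LHS]big_mkcond /=; apply: eq_bigr => i _.
rewrite -big_mkcondr /=; case: ifP => Ai.
  rewrite (big_pred1 [set i]) // => B /=.
  by rewrite andbC; case: eqP => // ->; rewrite sub1set Ai.
by rewrite big1 // => B /andP[sBA /eqP BE]; move: sBA; rewrite BE sub1set Ai.
Qed.

Lemma deg_le_bin k : deg_le k (fun A => 'C(#|A|, k)%:R).
Proof.
exists (fun B => (#|B| == k)%:R) => [B|A]; first by case: ltngtP.
rewrite -natr_sum -cards_draws -sum1_card; congr (_%:R).
rewrite [RHS]big_mkcond [LHS]big_mkcond; apply: eq_bigr => B _.
by rewrite inE; case: (B \subset A); case: eqP.
Qed.

Lemma deg_leD d f g : deg_le d f -> deg_le d g -> deg_le d (fun A => f A + g A).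
Proof.
move=> [c cd cE] [c' cd' cE']; exists (fun B => c B + c' B) => [B ltdB|A].
  by rewrite cd ?cd' ?addr0.
by rewrite cE cE' -big_split.
Qed.

Lemma deg_le_bigD (J : Type) (r : seq J) d (F : J -> {set I} -> R) :
  (forall j, deg_le d (F j)) -> deg_le d (fun A => \sum_(j <- r) F j A).
Proof.
move=> dF; elim: r => [|j r IHr].
  by apply: eq_deg_le (deg_leW _ (deg_le_cst 0)) => // A; rewrite big_nil.
by apply: eq_deg_le (deg_leD (dF j) IHr) => A; rewrite big_cons.
Qed.

Lemma deg_leM d d' f g :
  deg_le d f -> deg_le d' g -> deg_le (d + d') (fun A => f A * g A).
Proof.
move=> [c cd cE] [c' cd' cE'].
exists (fun D => \sum_(B : {set I}) \sum_(C : {set I} | B :|: C == D) c B * c' C).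
  move=> D ltD; rewrite big1 // => B _; rewrite big1 // => C /eqP BCD.
  case: (ltnP d #|B|) => [/cd -> | leB]; first by rewrite mul0r.
  case: (ltnP d' #|C|) => [/cd' -> | leC]; first by rewrite mulr0.
  move: ltD; rewrite ltnNge -BCD (leq_trans (leq_card_setU B C).1) //.
  exact: leq_add.
move=> A; rewrite cE cE' mulr_suml big_mkcond /= exchange_big /=.
apply: eq_bigr => B _; rewrite mulr_sumr.
rewrite (exchange_big_dep predT) //=.
case: ifP => sBA; last first.
  rewrite big1 // => C _; rewrite big1 // => D /andP[sDA /eqP BCD].
  by move: sDA; rewrite -BCD subUset sBA.
rewrite [LHS]big_mkcond /=; apply: eq_bigr => C _.
case: ifP => sCA.
  rewrite (big_pred1 (B :|: C)) // => D /=.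
  by rewrite eq_sym andbC; case: eqP => // ->; rewrite subUset sBA.
by rewrite big1 // => D /andP[sDA /eqP BCD]; move: sDA; rewrite -BCD subUset sCA andbF.
Qed.

Lemma deg_leX d f k : deg_le d f -> deg_le (k * d) (fun A => f A ^+ k).
Proof.
move=> df; elim: k => [|k IHk]; first exact: deg_le_cst.
by apply: eq_deg_le (deg_leM df IHk) => A; rewrite exprS.
Qed.

Lemma deg_le_prod (J : Type) (r : seq J) d (F : J -> {set I} -> R) :
  (forall j, deg_le d (F j)) ->
  deg_le (d * size r) (fun A => \prod_(j <- r) F j A).
Proof.
move=> dF; elim: r => [|j r IHr] /=.
  by rewrite muln0; apply: eq_deg_le (deg_le_cst 1) => A; rewrite big_nil.
rewrite mulnS; apply: eq_deg_le (deg_leM (dF j) IHr) => A.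
by rewrite big_cons.
Qed.

Lemma deg_leN d f : deg_le d f -> deg_le d (fun A => - f A).
Proof.
move=> df; apply: eq_deg_le (deg_leM (deg_le_cst (-1)) df) => A.
by rewrite mulN1r.
Qed.

(** Adding or removing an index outside [B] pairs the sets of even and of odd
    size. *)
Lemma signed_sum_superset B : B != setT ->
  \sum_(A : {set I} | B \subset A) (-1) ^+ #|A| = 0 :> R.
Proof.
rewrite -subTset => /subsetPn[i _ nBi].
rewrite (bigID (fun A => i \in A)) /=.
rewrite (reindex_onto (fun A => i |: A) (fun A => A :\ i)) /=; last first.
  by move=> A /andP[_ Ai]; rewrite setD1K.
rewrite (eq_bigl (fun A => (B \subset A) && (i \notin A))) => [|A].
  rewrite -big_split big1 //= => A /andP[_ nAi].
  by rewrite cardsU1 nAi exprS mulN1r addNr.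
rewrite setU11 andbT; case: (boolP (i \in A)) => Ai.
  rewrite andbF andbC; case: eqP => // /setP/(_ i).
  by rewrite !inE eqxx Ai.
by rewrite setU1K // eqxx !andbT -subDset (setDidPl _) // disjoint_sym disjoints1.
Qed.

(** Only the monomial of the full set has a nonzero signed sum. Existence
    results follow as from the Chevalley-Warning theorem. *)
Lemma signed_sum_deg_lt d f : deg_le d f -> (d < #|I|)%N ->
  \sum_(A : {set I}) (-1) ^+ #|A| * f A = 0.
Proof.
move=> [c cd cE] ltdI.
under eq_bigr => A _ do rewrite cE mulr_sumr.
rewrite (exchange_big_dep predT) //= big1 // => B _; rewrite -mulr_suml.
have [-> | /signed_sum_superset ->] := eqVneq B setT; last by rewrite mul0r.
by rewrite cd ?mulr0 // cardsT.
Qed.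

End Degree.

(** * Signed counts of zero-sum subsequences *)

(** As a function of [m] the left-hand side is a polynomial of degree [q] that
    takes the value [1] at [0]; at positive arguments it is a binomial
    coefficient, whose divisibility by [p] is controlled by the next lemma. *)
Lemma alternating_bin (R : comNzRingType) (m q : nat) :
  (\sum_(j < q.+1) (-1) ^+ j * 'C(m.+1, j)%:R = (-1) ^+ q * 'C(m, q)%:R :> R)%R.
Proof.
elim: q => [|q IHq]; first by rewrite big_ord1 !bin0.
by rewrite big_ord_recr /= IHq binS natrD exprS; ring.
Qed.

Lemma dvdn_bin_pred p e m : prime p -> 0 < m -> ~~ (p ^ e %| m) ->
  p %| 'C(m.-1, (p ^ e).-1).
Proof.
move=> p_pr m_gt0; apply: contraR => np.
rewrite -(@Gauss_dvdl _ _ 'C(m.-1, (p ^ e).-1)) ?coprimeXl ?prime_coprime //.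
have q_gt0 : 0 < p ^ e by rewrite expn_gt0 prime_gt0.
by have := mul_bin_diag m (p ^ e).-1; rewrite prednK // => ->; apply: dvdn_mulr.
Qed.

Section ZeroSumCount.

Local Open Scope ring_scope.

Variables (p : nat) (K : finType) (X : Type) (h : K -> X -> 'F_p).
Hypothesis p_pr : prime p.
Implicit Types s : seq X.

Definition zero_sum s := [forall k, \sum_(x <- s) h k x == 0].

Lemma zero_sumP s : reflect (forall k, \sum_(x <- s) h k x = 0) (zero_sum s).
Proof. exact: 'forall_eqP. Qed.

(** Subsequences are indexed by sets of positions, because equal terms at
    different positions have to be counted separately. *)
Definition subseq_at s (A : {set 'I_(size s)}) := [seq tnth (in_tuple s) i | i <- enum A].

Lemma size_subseq_at s (A : {set 'I_(size s)}) : size (subseq_at A) = #|A|.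
Proof. by rewrite size_map cardE. Qed.

Lemma sum_subseq_at s (A : {set 'I_(size s)}) (w : X -> 'F_p) :
  \sum_(x <- subseq_at A) w x = \sum_(i in A) w (tnth (in_tuple s) i).
Proof. by rewrite big_map big_enum. Qed.

(** By Fermat's little theorem [1 - L ^+ p.-1] is the indicator of [L = 0]. *)
Lemma deg_le_zero_sum s :
  deg_le (p.-1 * #|K|)
    (fun A : {set 'I_(size s)} => (zero_sum (subseq_at A))%:R : 'F_p).
Proof.
pose L k (A : {set 'I_(size s)}) := \sum_(i in A) h k (tnth (in_tuple s) i).
have dL k : deg_le p.-1 (fun A => 1 - L k A ^+ p.-1).
  apply: deg_leD; first exact: deg_leW (deg_le_cst _ _).
  by apply: deg_leN; rewrite -[X in deg_le X]muln1; apply/deg_leX/deg_le_sum.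
rewrite cardE; apply: eq_deg_le (deg_le_prod (enum K) dL) => A.
have LE k : 1 - L k A ^+ p.-1 = (L k A == 0)%:R.
  have [->|nz_u] := eqVneq (L k A) 0.
    have /negPf p1 : p.-1 != 0 by case: (p) p_pr => [|[]].
    by rewrite expr0n p1 subr0.
  have : L k A ^+ p.-1.+1 = L k A.
    by rewrite prednK ?prime_gt0 // -[RHS]expf_card card_Fp.
  by rewrite exprS => /(canRL (mulKf nz_u)); rewrite mulVf // => ->; rewrite subrr.
rewrite big_enum /=; case zA: (zero_sum _).
  rewrite big1 // => k _; rewrite LE.
  by move/zero_sumP/(_ k): zA; rewrite sum_subseq_at -/(L k A) => ->; rewrite eqxx.
move/negbT: zA => /forallPn[k]; rewrite sum_subseq_at => /negPf nz.
by rewrite (bigD1 k) //= LE nz mul0r.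
Qed.

Lemma signed_zero_sum s : (p.-1 * #|K| < size s)%N ->
  \sum_(A : {set 'I_(size s)}) (-1) ^+ #|A| * (zero_sum (subseq_at A))%:R = 0 :> 'F_p.
Proof.
by move=> lts; apply: signed_sum_deg_lt (deg_le_zero_sum s) _; rewrite card_ord.
Qed.

End ZeroSumCount.

Lemma perm_subseq_atC (X : eqType) (s : seq X) (A : {set 'I_(size s)}) :
  perm_eq (subseq_at A ++ subseq_at (~: A)) s.
Proof.
rewrite -map_cat -[X in perm_eq _ X](map_tnth_enum (in_tuple s)).
apply: perm_map; apply: uniq_perm.
- rewrite cat_uniq !enum_uniq andbT /=; apply/hasPn => i.
  by rewrite !mem_enum inE.
- exact: enum_uniq.
by move=> i; rewrite mem_cat !mem_enum !inE orbN.
Qed.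

Section ZeroSumExistence.

Local Open Scope ring_scope.

Variables (p : nat) (K : finType) (X : eqType) (h : K -> X -> 'F_p).
Hypothesis p_pr : prime p.
Implicit Types s : seq X.

(** The signed sum over the zero-sum subsequences, weighted by the polynomial in
    their length that vanishes modulo [p] unless [p ^ e] divides this length,
    is zero. The empty subsequence contributes [1], so another one contributes
    too. *)
Lemma zero_sum_exists_length s e :
    (p.-1 * #|K| + (p ^ e).-1 < size s)%N ->
  exists T U, [/\ perm_eq (T ++ U) s, T != [::], zero_sum h T & (p ^ e %| size T)%N].
Proof.
move=> lts; apply: contrapT => noT.
have q_gt0 : (0 < p ^ e)%N by rewrite expn_gt0 prime_gt0.
pose f (A : {set 'I_(size s)}) : 'F_p :=
  (zero_sum h (subseq_at A))%:R * \sum_(j < p ^ e) (-1) ^+ j * 'C(#|A|, j)%:R.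
have df : deg_le (p.-1 * #|K| + (p ^ e).-1) f.
  apply: deg_leM; first exact: deg_le_zero_sum.
  apply: deg_le_bigD => j.
  apply: (deg_leW _ (deg_leM (deg_le_cst _ _) (deg_le_bin _ _ _))).
  by rewrite add0n -ltnS prednK.
have f0 : f set0 = 1.
  rewrite /f; have -> : zero_sum h (subseq_at (set0 : {set 'I_(size s)})).
    by apply/zero_sumP => k; rewrite sum_subseq_at big_set0.
  rewrite mul1r -(prednK q_gt0) big_ord_recl cards0 bin0 mulr1 expr0.
  by rewrite big1 ?addr0 // => j _; rewrite bin0n mulr0.
have := signed_sum_deg_lt df; rewrite card_ord => /(_ lts).
rewrite (bigD1 set0) //= f0 cards0 mul1r big1 ?addr0 => [/eqP|A nzA].
  by rewrite oner_eq0.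
rewrite /f; case zA: (zero_sum _ _); last by rewrite mul0r mulr0.
have A_gt0 : (0 < #|A|)%N by rewrite card_gt0.
rewrite mul1r -(prednK q_gt0) -(prednK A_gt0) alternating_bin /=.
have : ~~ (p ^ e %| #|A|)%N.
  apply/negP => qA; apply: noT.
  exists (subseq_at A), (subseq_at (~: A)); split=> //.
  - exact: perm_subseq_atC.
  - by rewrite -size_eq0 size_subseq_at -lt0n.
  - by rewrite size_subseq_at.
move=> /(dvdn_bin_pred p_pr A_gt0).
rewrite (dvdn_pcharf (pchar_Fp p_pr)) => /eqP ->.
by rewrite !mulr0.
Qed.

Lemma zero_sum_exists s : (p.-1 * #|K| < size s)%N ->
  exists T U, [/\ perm_eq (T ++ U) s, T != [::] & zero_sum h T].
Proof.
move=> lts; have := @zero_sum_exists_length s 0; rewrite expn0 addn0.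
by move=> /(_ lts) [T [U [? ? ? _]]]; exists T, U.
Qed.

Lemma zero_sum_cat s t : zero_sum h s -> zero_sum h t -> zero_sum h (s ++ t).
Proof.
move=> /zero_sumP s0 /zero_sumP t0; apply/zero_sumP => k.
by rewrite big_cat /= s0 t0 addr0.
Qed.

Lemma perm_zero_sum s t : perm_eq s t -> zero_sum h s = zero_sum h t.
Proof. by move=> st; apply: eq_forallb => k; rewrite (perm_big _ st). Qed.

(** After appending a term [x'] with coordinates opposite to those of [x], the
    zero-sum subsequences are the empty one and the pairs of [x'] with a term
    of [U] that has the coordinates of [x]; their signed count vanishes modulo
    [p]. *)
Lemma count_same_coord (x x' : X) (U : seq X) :
    (forall k, h k x' = - h k x) ->
    (p.-1 * #|K| < (size U).+1)%N ->
    (forall V W, perm_eq (V ++ W) U -> zero_sum h V -> V = [::]) ->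
    (forall V W, perm_eq (V ++ W) U -> zero_sum h (x' :: V) -> size V = 1%N) ->
  (p %| (count (fun u => [forall k, h k u == h k x]) U).+1)%N.
Proof.
move=> x'E ltU U0 U1; set same := fun u => _.
have := @signed_zero_sum p K X h p_pr (x' :: U) ltU.
pose tU := in_tuple U.
pose D := [set i : 'I_(size U) | same (tnth tU i)].
pose pair (i : 'I_(size U)) : {set 'I_(size U).+1} := [set ord0; lift ord0 i].
have pair_inj : injective pair.
  move=> i j /setP/(_ (lift ord0 i)); rewrite !inE eqxx orbT.
  by rewrite eq_sym (negPf (neq_lift _ _)) (inj_eq lift_inj) => /esym/eqP.
have tnthS i : tnth (in_tuple (x' :: U)) (lift ord0 i) = tnth tU i.
  by rewrite !(tnth_nth x').
have zsP (A : {set 'I_(size (x' :: U))}) : A != set0 ->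
    zero_sum h (subseq_at A) = (A \in pair @: D).
  move=> nzA; apply/idP/imsetP => [zA | [i]]; last first.
    rewrite inE => /forallP same_i ->; apply/zero_sumP => k.
    rewrite sum_subseq_at big_setU1 ?inE //= big_set1 tnthS (eqP (same_i k)).
    by rewrite (tnth_nth x') /= x'E // addNr.
  have AC := perm_subseq_atC A.
  case: (boolP (ord0 \in A)) => A0; last first.
    have x'W : x' \in subseq_at (~: A).
      by apply/mapP; exists ord0; rewrite ?mem_enum ?inE // (tnth_nth x').
    have {}AC : perm_eq (subseq_at A ++ rem x' (subseq_at (~: A))) U.
      rewrite -(perm_cons x') -(permPr AC) -cat1s perm_catCA perm_cat2l perm_sym.
      exact: perm_to_rem.
    have /eqP := U0 _ _ AC zA; rewrite -size_eq0 size_subseq_at cards_eq0.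
    by rewrite (negPf nzA).
  have x'V : x' \in subseq_at A.
    by apply/mapP; exists ord0; rewrite ?mem_enum // (tnth_nth x').
  have V' := perm_to_rem x'V.
  have {}AC : perm_eq (rem x' (subseq_at A) ++ subseq_at (~: A)) U.
    by rewrite -(perm_cons x') -(permPr AC) -cat_cons perm_cat2r perm_sym.
  have szV : size (rem x' (subseq_at A)) = 1%N.
    by apply: U1 AC _; rewrite -(perm_zero_sum V').
  have : #|A :\ ord0| == 1%N.
    have := perm_size V'; rewrite /= szV size_subseq_at (cardsD1 ord0) A0 add1n.
    by case=> ->.
  case/cards1P => j Aj; have : j \in A :\ ord0 by rewrite Aj set11.
  rewrite !inE => /andP[j0 _]; case: (unliftP ord0 j) => [i jE | jE]; last first.
    by rewrite jE eqxx in j0.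
  have AE : A = pair i by rewrite /pair -jE -Aj setD1K.
  exists i => //; rewrite inE; apply/forallP => k.
  move/zero_sumP/(_ k)/eqP: zA; rewrite sum_subseq_at AE big_setU1 ?inE //=.
  by rewrite big_set1 tnthS (tnth_nth x') /= x'E // addrC subr_eq0.
rewrite (bigD1 set0) //= cards0 mul1r.
have -> : zero_sum h (subseq_at (set0 : {set 'I_(size (x' :: U))})).
  by apply/zero_sumP => k; rewrite sum_subseq_at big_set0.
have -> : \sum_(A : {set 'I_(size (x' :: U))} | A != set0)
    (-1) ^+ #|A| * (zero_sum h (subseq_at A))%:R = #|D|%:R :> 'F_p.
  rewrite -(card_imset _ pair_inj) -sum1_card natr_sum big_mkcond [RHS]big_mkcond.
  apply: eq_bigr => A _ /=; have [->|nzA] := eqVneq A set0.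
    rewrite ifF //; apply/negP => /imsetP[i _ /setP/(_ ord0)].
    by rewrite !inE eqxx.
  rewrite zsP //; case: ifP => [|_]; last by rewrite mulr0.
  by case/imsetP => i _ ->; rewrite cards2 /= mulr1 expr2 mulrN1 opprK.
rewrite -natrD add1n => /eqP; rewrite -(dvdn_pcharf (pchar_Fp p_pr)).
congr (_ %| _.+1)%N; rewrite -[U in RHS]/(tval tU) -(map_tnth_enum tU) count_map.
rewrite cardE size_filter /= enumT; apply: eq_count => i; exact: in_set.
Qed.
End ZeroSumExistence.

(** * Product-one subsequences in a finite group *)

Section ProductOneSequences.

Local Open Scope group_scope.

Variables (gT : finGroupType) (G : {group gT}).
Implicit Types (g h : gT) (s t S V W : seq gT).

Definition seqmul s : gT := \prod_(g <- s) g.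

Definition prod_one T : Prop := exists2 t, perm_eq t T & seqmul t = 1.

Lemma seqmul_cat s t : seqmul (s ++ t) = seqmul s * seqmul t.
Proof. exact: big_cat. Qed.

Lemma seqmul_nseq n g : seqmul (nseq n g) = g ^+ n.
Proof. by rewrite /seqmul big_nseq -Monoid.iteropE. Qed.

Lemma seqmul_in s : all (mem G) s -> seqmul s \in G.
Proof. by move=> sG; rewrite /seqmul big_seq; apply: group_prod => g /(allP sG). Qed.

Lemma prod_one_cat V W : prod_one V -> prod_one W -> prod_one (V ++ W).
Proof.
move=> [v vV v1] [w wW w1]; exists (v ++ w); first exact: perm_cat.
by rewrite seqmul_cat v1 w1 mulg1.
Qed.

Lemma seqmul_translate g t : {in t, forall h, commute g h} ->
  seqmul (map (mulg g) t) = g ^+ size t * seqmul t.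
Proof.
rewrite /seqmul big_map; elim: t => [|h t IHt] gt; first by rewrite !big_nil mulg1.
rewrite !big_cons IHt => [|k kt]; last by apply: gt; rewrite inE kt orbT.
rewrite expgS -!mulgA; congr (_ * _); rewrite !mulgA; congr (_ * _).
by apply: commuteX; apply/commute_sym/gt/mem_head.
Qed.

Variable d : nat.
Hypothesis prod_one_long : forall S, all (mem G) S -> (d < size S)%N ->
  exists V W, [/\ perm_eq (V ++ W) S, V != [::] & prod_one V].

(** Product-one parts can be split off until at most [d] terms remain, and their
    concatenation is again product-one. *)
Lemma prod_one_extract S : all (mem G) S ->
  exists V W, [/\ perm_eq (V ++ W) S, prod_one V & (size W <= d)%N].
Proof.
have [n] := ubnP (size S); elim: n S => // n IHn S /ltnSE leSn SG.
have [leS | ltS] := leqP (size S) d.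
  by exists [::], S; split=> //; exists [::]; rewrite // /seqmul big_nil.
have [V1 [W1 [VW1 nV1 V1_1]]] := prod_one_long SG ltS.
have szS : (size V1 + size W1)%N = size S by rewrite -size_cat (perm_size VW1).
have V1_gt0 : (0 < size V1)%N by rewrite lt0n size_eq0.
have [||V2 [W2 [VW2 V2_1 leW2]]] := IHn W1.
- by apply: leq_trans leSn; rewrite -szS -[X in (X < _)%N]add0n ltn_add2r.
- by have := perm_all (mem G) VW1; rewrite SG all_cat => /andP[].
exists (V1 ++ V2), W2; split=> //; last exact: prod_one_cat.
by rewrite -catA -(permPr VW1) perm_cat2l.
Qed.

(** The previous lemma is applied to the sequence of the [g^-1 * h], whose
    products differ from those of the terms [h] by powers of [g]. *)
Lemma central_extract g S :
    g \in G -> {in G, forall h, commute g h} -> all (mem G) S ->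
  exists V W, [/\ perm_eq (V ++ W) S,
    exists2 t, perm_eq t V & seqmul t = g ^+ size V & (size W <= d)%N].
Proof.
move=> gG cg SG.
have S'G : all (mem G) (map (mulg g^-1) S).
  by rewrite all_map; apply/allP => h /(allP SG) hG; rewrite /= groupMl ?groupV.
have [V [W [VW [t tV t1] leW]]] := prod_one_extract S'G.
exists (map (mulg g) V), (map (mulg g) W); rewrite !size_map; split=> //.
  by rewrite -map_cat -[S in perm_eq _ S](mapK (mulKVg g)) perm_map.
exists (map (mulg g) t); first exact: perm_map.
rewrite seqmul_translate ?t1 ?mulg1 ?(perm_size tV) // => h ht; apply: cg.
have: all (mem G) (V ++ W) by rewrite (perm_all _ VW).
by move/allP; apply; rewrite mem_cat -(perm_mem tV) ht.
Qed.

(** The terms other than [g] contain a part [V] with an ordering of product [g ^+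
    size V] that leaves out at most [d] of them; enough copies of [g] remain
    to complete [V] to length [#|G|], which makes the product [g ^+ #|G| = 1]. *)
Lemma prod_one_central_frequent S g : all (mem G) S -> size S = (#|G| + d)%N ->
    g \in S -> {in G, forall h, commute g h} -> (d <= count_mem g S)%N ->
  exists V W, [/\ perm_eq (V ++ W) S, prod_one V & size V = #|G|].
Proof.
move=> SG szS gS cg leg; set m := count_mem g S in leg.
have gG : g \in G by apply: (allP SG).
pose S' := filter (predC (pred1 g)) S.
have S'G : all (mem G) S' by apply/allP => h; rewrite mem_filter => /andP[_ /(allP SG)].
have SE : perm_eq (nseq m g ++ S') S.
  have fE : filter (pred1 g) S = nseq m g.
    by rewrite /m -size_filter; apply/all_pred1P/filter_all.
  by rewrite -fE; apply/permPl/perm_filterC.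
have [V [W [VW [t tV tE] leW]]] := central_extract gG cg S'G.
have szVW : (m + (size V + size W))%N = (#|G| + d)%N.
  by rewrite -szS -(perm_size SE) size_cat size_nseq -(perm_size VW) size_cat.
have arith (q e r v w : nat) : (e <= r -> w <= e -> r + (v + w) = q + e ->
   v <= q /\ q - v <= r)%N by clear; lia.
have [leV lem] := arith _ _ _ _ _ leg leW szVW.
exists (V ++ nseq (#|G| - size V) g), (W ++ nseq (m - (#|G| - size V)) g); split.
- apply: perm_trans SE; rewrite -[in nseq m g](subnKC lem) nseqD.
  apply/seq.permP => a; have := seq.permP VW a; rewrite !count_cat => <-; ring.
- exists (t ++ nseq (#|G| - size V) g); first by rewrite perm_cat2r.
  by rewrite seqmul_cat tE seqmul_nseq -expgD subnKC // expg_cardG.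
by rewrite size_cat size_nseq subnKC.
Qed.

End ProductOneSequences.

(** * Coordinates on the Heisenberg group *)

Section Coordinates.

Local Open Scope ring_scope.

Variable p : nat.
Hypothesis p_pr : prime p.
Local Notation G := (UT3_group p).
Implicit Types (g h : {'GL_3(p)}) (x y z : 'F_p).

Definition cx g : 'F_p := GLval g 0 1.
Definition cy g : 'F_p := GLval g 1 2.
(** Twice the central coordinate of the logarithm of the matrix; with this choice
    [cz] is additive on commuting elements. *)
Definition cz g : 'F_p := GLval g 0 2 *+ 2 - cx g * cy g.

(** The upper right entry of the commutator of [g] and [h], and the determinant
    of their images in the plane. *)
Definition omega g h : 'F_p := cx g * cy h - cx h * cy g.

Lemma UT3P g : g \in UT3 p ->
  [/\ (GLval g 0 0 = 1), (GLval g 1 1 = 1) & (GLval g 2 2 = 1)] /\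
  [/\ (GLval g 1 0 = 0), (GLval g 2 0 = 0) & (GLval g 2 1 = 0)].
Proof.
rewrite inE => /'forall_forallP gP.
by split; split; rewrite (eqP (implyP (gP _ _) _)).
Qed.

Lemma ord3P (k : 'I_3) : [\/ k = 0, k = 1 | k = 2].
Proof.
by case: k => [[|[|[|]]] ?] //; [apply: Or31|apply: Or32|apply: Or33]; apply: val_inj.
Qed.

Lemma sum_ord3 (f : 'I_3 -> 'F_p) : \sum_i f i = f 0 + f 1 + f 2.
Proof.
rewrite !big_ord_recl big_ord0 addr0 addrA; congr (f _ + f _ + f _); exact: val_inj.
Qed.

Lemma UT3M g h : g \in G -> h \in G -> (g * h)%g \in G.
Proof. by move=> gG hG; rewrite groupM. Qed.

Lemma cxM g h : g \in G -> h \in G -> cx (g * h)%g = cx g + cx h.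
Proof.
move=> /UT3P[[g0 g1 g2] [g10 g20 g21]] /UT3P[[h0 h1 h2] [h10 h20 h21]].
by rewrite /cx GL_MxE mxE sum_ord3 g0 h1 h21; ring.
Qed.

Lemma cyM g h : g \in G -> h \in G -> cy (g * h)%g = cy g + cy h.
Proof.
move=> /UT3P[[g0 g1 g2] [g10 g20 g21]] /UT3P[[h0 h1 h2] [h10 h20 h21]].
by rewrite /cy GL_MxE mxE sum_ord3 g10 g1 h2; ring.
Qed.

Lemma czM g h : g \in G -> h \in G -> cz (g * h)%g = cz g + cz h + omega g h.
Proof.
move=> gG hG; rewrite /cz cxM // cyM // GL_MxE mxE sum_ord3.
have [[g0 g1 g2] [g10 g20 g21]] := UT3P gG.
have [[h0 h1 h2] [h10 h20 h21]] := UT3P hG.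
by rewrite g0 h2 /omega /cx /cy; ring.
Qed.

Lemma cx1 : cx 1%g = 0. Proof. by rewrite /cx GL_1E mxE. Qed.
Lemma cy1 : cy 1%g = 0. Proof. by rewrite /cy GL_1E mxE. Qed.
Lemma cz1 : cz 1%g = 0. Proof. by rewrite /cz cx1 mul0r subr0 GL_1E mxE mul0rn. Qed.

Definition UT3_mx x y z : 'M['F_p]_3 :=
  \matrix_(i, j) (if (i, j) == (0, 1) then x else if (i, j) == (1, 2) then y
                  else if (i, j) == (0, 2) then z else (i == j)%:R).

Lemma UT3_mx_unit x y z : UT3_mx x y z \is a GRing.unit.
Proof.
rewrite -[_ \is a _]/(_ \in unitmx) unitmxE -det_tr det_trig; last first.
  apply/is_trig_mxP => i j; rewrite !mxE; case: (ord3P i) (ord3P j) => -> [] -> //=.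
by rewrite big1 ?unitr1 // => i _; rewrite !mxE; case: (ord3P i) => ->.
Qed.

Definition UT3_elt x y z : {'GL_3(p)} := FinRing.unit _ (UT3_mx_unit x y z).

Lemma UT3_elt_coord x y z :
  [/\ cx (UT3_elt x y z) = x, cy (UT3_elt x y z) = y
    & cz (UT3_elt x y z) = z *+ 2 - x * y].
Proof. by rewrite /cz /cx /cy /= !mxE. Qed.

Lemma UT3_elt_in x y z : UT3_elt x y z \in G.
Proof.
rewrite inE; apply/'forall_forallP => i j; apply/implyP.
by rewrite /= mxE; case: (ord3P i) (ord3P j) => -> [] ->.
Qed.

Lemma UT3_entries_inj g h : g \in G -> h \in G ->
  cx g = cx h -> cy g = cy h -> GLval g 0 2 = GLval h 0 2 -> g = h.
Proof.
move=> /UT3P[[g0 g1 g2] [g10 g20 g21]] /UT3P[[h0 h1 h2] [h10 h20 h21]].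
rewrite /cx /cy => ex ey ez; suff E i j : GLval g i j = GLval h i j.
  by apply/val_inj/matrixP => i j; exact: E.
by case: (ord3P i) (ord3P j) => -> [] ->; 
  do ?[exact: ex | exact: ey | exact: ez];
  do [exact: etrans g0 _ | exact: etrans g1 _ | exact: etrans g2 _
     | exact: etrans g10 _ | exact: etrans g20 _ | exact: etrans g21 _].
Qed.

Lemma card_UT3 : #|G| = (p ^ 3)%N.
Proof.
pose f (t : 'F_p * 'F_p * 'F_p) := UT3_elt t.1.1 t.1.2 t.2.
have fK : injective f.
  move=> [[x y] z] [[x' y'] z'] E.
  have := (congr1 cx E, congr1 cy E, congr1 (fun g : {'GL_3(p)} => GLval g 0 2) E).
  by rewrite /f /cx /cy /= !mxE /= => -[[-> ->] ->].
have -> : #|G| = #|f @: setT|.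
  apply: eq_card => g; apply/idP/imsetP => [gG | [t _ ->]]; last exact: UT3_elt_in.
  exists (cx g, cy g, GLval g 0 2) => //.
  by apply: UT3_entries_inj; rewrite ?UT3_elt_in // /cx /cy /= mxE.
by rewrite card_imset // cardsT !card_prod card_Fp // !expnS expn0 muln1 mulnA.
Qed.

Hypothesis p_odd : odd p.

Lemma two_neq0 : 2 != 0 :> 'F_p.
Proof.
rewrite -(dvdn_pcharf (pchar_Fp p_pr)); apply/negP => /dvdn_leq - /(_ isT).
by case: (p) p_pr p_odd => [|[|[|]]].
Qed.

Lemma UT3_coord_inj g h : g \in G -> h \in G ->
  cx g = cx h -> cy g = cy h -> cz g = cz h -> g = h.
Proof.
move=> gG hG ex ey ez; apply: UT3_entries_inj => //.
have {}ez : GLval g 0 2 *+ 2 = GLval h 0 2 *+ 2.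
  by move: ez; rewrite /cz ex ey; apply: addIr.
by apply: (mulfI two_neq0); rewrite !mulr_natl.
Qed.

End Coordinates.

(** * Products of the orderings of a sequence *)

Lemma minnS_le q m n : minn q m <= n -> minn q m.+1 <= minn q n.+1.
Proof. by lia. Qed.

Section Orderings.

Local Open Scope ring_scope.

Variable p : nat.
Hypotheses (p_pr : prime p) (p_odd : odd p).
Local Notation G := (UT3_group p).
Implicit Types (g h k : {'GL_3(p)}) (c d : 'F_p) (s t T : seq {'GL_3(p)}) (X Y : {set 'F_p}).

Definition xy (k : bool) g : 'F_p := if k then cx g else cy g.
Definition xyz (k : option bool) g : 'F_p := if k is Some k' then xy k' g else cz g.

Definition central g : bool := (cx g == 0) && (cy g == 0).

Definition noncommuting T : bool := has (fun g => has (fun h => omega g h != 0) T) T.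

Lemma noncommutingP T :
  reflect (exists g h, [/\ g \in T, h \in T & omega g h != 0]) (noncommuting T).
Proof.
apply: (iffP hasP) => [[g gT /hasP[h hT nz]] | [g [h [gT hT nz]]]].
  by exists g, h.
by exists g => //; apply/hasP; exists h.
Qed.

Lemma perm_noncommuting s t : perm_eq s t -> noncommuting s = noncommuting t.
Proof.
move=> /perm_mem st; apply/noncommutingP/noncommutingP => -[g [h [gT hT nz]]].
  by exists g, h; rewrite -!st.
by exists g, h; rewrite !st.
Qed.

Lemma commuting_omega T g h :
  ~~ noncommuting T -> g \in T -> h \in T -> omega g h = 0.
Proof.
move=> cT gT hT; apply/eqP; apply: contraNT cT => nz.
by apply/noncommutingP; exists g, h.
Qed.

Lemma omegaC g h : omega g h = - omega h g. Proof. by rewrite /omega; ring. Qed.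

Lemma omegaxx g : omega g g = 0. Proof. exact: subrr. Qed.

Lemma omega_central g h : central h -> omega g h = 0.
Proof. by case/andP => /eqP hx /eqP hy; rewrite /omega hx hy; ring. Qed.

(** The vectors parallel to a nonzero vector of the plane form a line. *)
Lemma omega_trans g h k :
  ~~ central k -> omega g k = 0 -> omega h k = 0 -> omega g h = 0.
Proof.
move=> nk gk hk; apply/eqP; move: nk; apply: contraR => nz.
have Ex : omega g h * cx k = 0.
  transitivity (omega g k * cx h - omega h k * cx g); first by rewrite /omega; ring.
  by rewrite gk hk !mul0r subr0.
have Ey : omega g h * cy k = 0.
  transitivity (omega g k * cy h - omega h k * cy g); first by rewrite /omega; ring.
  by rewrite gk hk !mul0r subr0.
by apply/andP; split; rewrite -(mulrI_eq0 _ (mulfI nz)) ?Ex ?Ey.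
Qed.

Lemma cx_seqmul s : all (mem G) s -> cx (seqmul s) = \sum_(g <- s) cx g.
Proof.
rewrite /seqmul; elim: s => [|g s IHs] /=; first by rewrite !big_nil cx1.
by move=> /andP[gG sG]; rewrite !big_cons cxM ?IHs //; apply: seqmul_in.
Qed.

Lemma cy_seqmul s : all (mem G) s -> cy (seqmul s) = \sum_(g <- s) cy g.
Proof.
rewrite /seqmul; elim: s => [|g s IHs] /=; first by rewrite !big_nil cy1.
by move=> /andP[gG sG]; rewrite !big_cons cyM ?IHs //; apply: seqmul_in.
Qed.

Lemma central_seqmul s : all (mem G) s -> central (seqmul s) = zero_sum xy s.
Proof.
move=> sG; rewrite /central cx_seqmul // cy_seqmul //.
apply/andP/zero_sumP => [[/eqP sx /eqP sy] [] // | s0].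
by rewrite (s0 true) (s0 false) eqxx.
Qed.

Lemma omega_seqmul g s :
  all (mem G) s -> omega g (seqmul s) = \sum_(h <- s) omega g h.
Proof.
move=> sG; rewrite /omega cx_seqmul // cy_seqmul //.
by rewrite mulr_sumr mulr_suml -sumrB.
Qed.

Lemma cz_seqmul_commuting s :
  all (mem G) s -> ~~ noncommuting s -> cz (seqmul s) = \sum_(g <- s) cz g.
Proof.
elim: s => [|g s IHs] /=; first by rewrite /seqmul !big_nil cz1.
move=> /andP[gG sG] cs; rewrite /seqmul !big_cons czM ?seqmul_in //.
rewrite -/(seqmul s) omega_seqmul // IHs //; last first.
  apply: contra cs => /noncommutingP[h [k [hs ks nz]]].
  by apply/noncommutingP; exists h, k; rewrite !inE hs ks !orbT.
rewrite [X in _ + X]big1_seq ?addr0 // => h /andP[_ hs].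
by apply: commuting_omega cs _ _; rewrite inE ?eqxx ?hs ?orbT.
Qed.

(** As the vector of the product does not depend on the ordering, the central
    coordinate determines it within [G]. *)
Definition products T : {set 'F_p} :=
  [set c in [seq cz (seqmul t) | t <- permutations T]].

Lemma productsP T c :
  reflect (exists2 t, perm_eq t T & cz (seqmul t) = c) (c \in products T).
Proof.
rewrite inE; apply: (iffP mapP) => [[t] | [t tT <-]].
  by rewrite mem_permutations => tT ->; exists t.
by exists t; rewrite ?mem_permutations.
Qed.

Lemma products_gt0 T : (0 < #|products T|)%N.
Proof. by apply/card_gt0P; exists (cz (seqmul T)); apply/productsP; exists T. Qed.

Lemma translation_closed X d : d != 0 -> X != set0 ->
  {in X, forall c, c + d \in X} -> X = setT.
Proof.
move=> nz_d /set0Pn[c0 c0X] Xd; apply/setP => c; rewrite in_setT.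
have Xn n : c0 + d *+ n \in X.
  by elim: n => [|n IHn]; rewrite ?addr0 // mulrSr addrA Xd.
have := Xn (nat_of_ord ((c - c0) / d)).
by rewrite -mulr_natr natr_Zp mulrC divfK // addrC subrK.
Qed.

(** This is the case of the Cauchy-Davenport inequality where one summand has two
    elements. *)
Lemma card_two_translates X Y c d : c != d -> X != set0 ->
  {in X, forall e, (c + e \in Y) /\ (d + e \in Y)} -> (minn p #|X|.+1 <= #|Y|)%N.
Proof.
move=> neq_cd X0 XY; pose X' := [set c + e | e in X].
have cX' : #|X'| = #|X| by apply: card_imset; apply: addrI.
have sX'Y : X' \subset Y by apply/subsetP => _ /imsetP[e /XY[? _] ->].
have [leY | ltY] := leqP #|Y| #|X|; last by rewrite geq_min ltY orbT.
have X'E : X' = Y by apply/eqP; rewrite eqEcard sX'Y cX'.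
suff -> : Y = setT by rewrite cardsT card_Fp // geq_minl.
apply: (@translation_closed _ (d - c)); first by rewrite subr_eq0 eq_sym.
  by rewrite -X'E imset_eq0.
move=> e; rewrite -X'E => /imsetP[e' /XY[_ de'] ->].
by rewrite X'E (_ : _ + _ = d + e') //; ring.
Qed.

(** Placing [g] first or last gives values that differ by twice [omega g (seqmul
    T)], so the values for [T] are translated by two distinct amounts. *)
Lemma products_cons g T : all (mem G) (g :: T) ->
  omega g (seqmul T) != 0 -> (minn p #|products T|.+1 <= #|products (g :: T)|)%N.
Proof.
move=> /=/andP[gG TG] nz.
apply: (@card_two_translates _ _ (cz g + omega g (seqmul T)) (cz g - omega g (seqmul T))).
- rewrite (inj_eq (addrI _)) -subr_eq0 opprK -mulr2n -mulr_natl mulf_neq0 //.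
  exact: two_neq0.
- by rewrite -card_gt0 products_gt0.
move=> c /productsP[t tT <-].
have tG : all (mem G) t by rewrite (perm_all _ tT).
have oE : omega g (seqmul t) = omega g (seqmul T).
  by rewrite !omega_seqmul // (perm_big _ tT).
split; apply/productsP.
  exists (g :: t); first by rewrite perm_cons.
  by rewrite {1}/seqmul big_cons czM ?seqmul_in // -/(seqmul t) oE; ring.
exists (rcons t g); first by rewrite perm_rcons perm_cons.
rewrite {1}/seqmul -cats1 big_cat big_seq1 czM ?seqmul_in //.
by rewrite -/(seqmul t) omegaC oE; ring.
Qed.


(** Induction on the length through [products_cons]: one needs a term [x] that
    does not commute with the product [e] of [T] and whose removal leaves a
    noncommuting sequence. Removing such an [x] keeps the sum nonzero, since
    [omega x e] is unchanged. *)
Lemma products_spread T : all (mem G) T -> all (predC central) T ->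
  noncommuting T -> ~~ zero_sum xy T -> (minn p (size T) <= #|products T|)%N.
Proof.
have [n] := ubnP (size T); elim: n T => // n IHn T /ltnSE leTn TG Tnc ncT nzT.
have perm_products s t : perm_eq s t -> products s = products t.
  move=> st; apply/setP => c; apply/productsP/productsP => -[r rs <-]; exists r => //.
    exact: perm_trans st.
  by apply: perm_trans rs _; rewrite perm_sym.
set e := seqmul T.
have oE x T' : perm_eq T (x :: T') -> omega x e = omega x (seqmul T').
  move=> TT'; have: all (mem G) (x :: T') by rewrite -(perm_all _ TT').
  move=> /andP[xG T'G]; rewrite /e !omega_seqmul // (perm_big _ TT') /= big_cons.
  by rewrite omegaxx add0r.
suff [x [T' [TT' xe le1]]] : exists x T', [/\ perm_eq T (x :: T'),
    omega x e != 0 & (minn p (size T') <= #|products T'|)%N].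
  rewrite (perm_products _ _ TT') (perm_size TT') /=.
  have T'G : all (mem G) (x :: T') by rewrite -(perm_all _ TT').
  have := products_cons T'G; rewrite -(oE _ _ TT') => /(_ xe).
  by apply: leq_trans; apply: minnS_le.
have step x T' : perm_eq T (x :: T') -> omega x e != 0 -> noncommuting T' ->
    (minn p (size T') <= #|products T'|)%N.
  move=> TT' xe ncT'.
  have := perm_all (mem G) TT'; have := perm_all (predC central) TT'.
  rewrite TG Tnc /= => /esym/andP[_ T'nc] /esym/andP[_ T'G].
  apply: IHn => //; first by move: leTn; rewrite (perm_size TT').
  rewrite -central_seqmul //; apply: contra xe => cT'.
  by rewrite (oE _ _ TT') omega_central.
have [x xT xe] : exists2 x, x \in T & omega x e != 0.
  have /noncommutingP[g [h [gT hT nz]]] := ncT.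
  have ne : ~~ central e by rewrite central_seqmul.
  have [ge | ge] := eqVneq (omega g e) 0; last by exists g.
  exists h => //; apply: contraNneq nz => he.
  by rewrite (omega_trans ne).
have TT' := perm_to_rem xT; set T' := rem x T in TT'.
have [ncT' | cT'] := boolP (noncommuting T').
  by exists x, T'; split=> //; apply: step TT' xe ncT'.
have [le1 | gt1] := leqP (size T') 1.
  exists x, T'; split=> //; rewrite geq_min (leq_trans le1) ?orbT //.
  exact: products_gt0.
(* The terms other than [x] lie on a line [L] not containing [x]; a term [y] of *)
(* [L] can be removed instead, because [x] and another term of [L] remain. *)
have [y yT xy_nz] : exists2 y, y \in T' & omega x y != 0.
  have T'G : all (mem G) T' by have := perm_all (mem G) TT'; rewrite TG => /esym/andP[].
  apply/hasP; apply: contraNT xe => /hasPn T'0.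
  rewrite (oE _ _ TT') omega_seqmul // big1_seq // => h /andP[_ /T'0/negbNE/eqP].
  by [].
have T'T'' := perm_to_rem yT; set T'' := rem y T' in T'T''.
have Tyx : perm_eq T (y :: x :: T'').
  apply: perm_trans TT' _; rewrite -(perm_cons x) in T'T''.
  by apply: perm_trans T'T'' _; rewrite (perm_catCA [:: x] [:: y]).
have ye : omega y e = omega y x.
  have T'G : all (mem G) (x :: T'').
    by have := perm_all (mem G) Tyx; rewrite TG => /esym/andP[].
  rewrite (oE _ _ Tyx) omega_seqmul // big_cons big1_seq ?addr0 // => h /andP[_ hT].
  by apply: commuting_omega cT' _ _ => //; rewrite (perm_mem T'T'') inE hT orbT.
have [w wT''] : exists w, w \in T''.
  move: gt1; rewrite (perm_size T'T'') /=; case: T'' {T'T'' Tyx} => // w ? _.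
  by exists w; rewrite mem_head.
have wT' : w \in T' by rewrite (perm_mem T'T'') inE wT'' orbT.
have yw : omega y w = 0 by apply: commuting_omega cT' _ _.
have nw : ~~ central w by apply: (allP Tnc); rewrite (perm_mem TT') inE wT' orbT.
exists y, (x :: T''); split=> //.
  by rewrite ye omegaC oppr_eq0.
apply: step Tyx _ _; first by rewrite ye omegaC oppr_eq0.
apply/noncommutingP; exists x, w; rewrite !inE eqxx wT'' orbT; split=> //.
by apply: contraNneq xy_nz => xw; rewrite (omega_trans nw xw yw).
Qed.

End Orderings.

(** * Noncommuting zero-sum sequences *)

Section Noncommuting.

Local Open Scope ring_scope.

Variable p : nat.
Hypotheses (p_pr : prime p) (p_odd : odd p).
Local Notation G := (UT3_group p).
Implicit Types (g h k : {'GL_3(p)}) (c d : 'F_p).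
Implicit Types (s t S T U V W : seq {'GL_3(p)}) (X Y : {set 'F_p}).

Lemma omega_zero_sum g s : zero_sum (@xy p) s -> \sum_(h <- s) omega g h = 0.
Proof.
move=> /zero_sumP s0; rewrite sumrB -mulr_sumr -mulr_suml.
by rewrite (s0 true) (s0 false) mulr0 mul0r subr0.
Qed.

(** In a zero-sum sequence the sum of the remaining terms is opposite to the term
    removed, so a line through these terms also contains that one. *)
Lemma noncommuting_behead x T :
  zero_sum (@xy p) (x :: T) -> noncommuting (x :: T) -> noncommuting T.
Proof.
move=> zT; apply: contraLR => cT.
have Tx y : y \in T -> omega y x = 0.
  move=> yT; have := omega_zero_sum y zT; rewrite big_cons big1_seq ?addr0 // => h.
  by move=> /andP[_]; apply: commuting_omega cT yT.
apply/negP => /noncommutingP[g [h []]]; rewrite !inE.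
move=> /predU1P[->|gT] /predU1P[->|hT]; rewrite ?omegaxx ?eqxx //.
- by rewrite omegaC Tx // oppr0 eqxx.
- by rewrite Tx // eqxx.
by rewrite (commuting_omega cT) // eqxx.
Qed.

Lemma zero_sum_cons_central x T :
  zero_sum (@xy p) (x :: T) -> zero_sum (@xy p) T -> central x.
Proof.
move=> /zero_sumP xT /zero_sumP T0; apply/andP; split; apply/eqP.
  by have := xT true; rewrite big_cons T0 addr0.
by have := xT false; rewrite big_cons T0 addr0.
Qed.

(** A zero-sum sequence is out of reach of [products_spread], but becomes
    accessible after one term is set aside in front. *)
Lemma products_zero_sum T : all (mem G) T -> all (predC (@central p)) T ->
  noncommuting T -> zero_sum (@xy p) T -> (minn p (size T).-1 <= #|products T|)%N.
Proof.
move=> TG Tnc ncT zT; have /noncommutingP[x [_ [xT _ _]]] := ncT.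
have TT' := perm_to_rem xT; set T' := rem x T in TT'.
have := perm_all (mem G) TT'; have := perm_all (predC (@central p)) TT'.
rewrite TG Tnc /= => /esym/andP[x_nc T'nc] /esym/andP[xG T'G].
rewrite (perm_noncommuting TT') (perm_zero_sum _ TT') in ncT zT.
have le' : (minn p (size T') <= #|products T'|)%N.
  apply: (products_spread p_pr p_odd T'G T'nc (noncommuting_behead zT ncT)).
  exact: contra (zero_sum_cons_central zT) x_nc.
rewrite (perm_size TT') /=; apply: leq_trans le' _.
rewrite -(card_imset _ (addrI (cz x + omega x (seqmul T')))); apply: subset_leq_card.
apply/subsetP => _ /imsetP[_ /productsP[t tT' <-] ->]; apply/productsP.
have tG : all (mem G) t by rewrite (perm_all _ tT').
exists (x :: t); first by rewrite (permPr TT') perm_cons.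
rewrite {1}/seqmul big_cons czM ?seqmul_in // -/(seqmul t).
by rewrite !omega_seqmul // (perm_big _ tT') /= addrAC.
Qed.

(** The Cauchy-Davenport bound for the set of subsequence sums. *)
Lemma card_sums T : all (fun g => cz g != 0) T ->
  exists2 X : {set 'F_p}, (minn p (size T).+1 <= #|X|)%N &
    {in X, forall c, exists V W, perm_eq (V ++ W) T /\ \sum_(g <- V) cz g = c}.
Proof.
elim: T => [|g T IHT] /=.
  exists [set 0] => [|_ /set1P ->]; first by rewrite cards1 geq_minr.
  by exists [::], [::]; rewrite big_nil.
move=> /andP[nz_g /IHT[X leX XP]].
exists (X :|: [set cz g + c | c in X]).
  have p_gt0 := prime_gt0 p_pr.
  have X0 : X != set0 by rewrite -card_gt0 (leq_trans _ leX) // leq_min p_gt0.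
  have := @card_two_translates _ p_pr X (X :|: [set cz g + c | c in X]) 0 (cz g).
  rewrite eq_sym => /(_ nz_g X0) le'.
  apply: leq_trans (le' _); first exact: minnS_le.
  by move=> c cX; rewrite add0r !inE cX imset_f ?orbT.
move=> c /setUP[/XP[V [W [VW <-]]] | /imsetP[_ /XP[V [W [VW <-]]] ->]].
  by exists V, (g :: W); rewrite -cat1s perm_catCA perm_cons.
by exists (g :: V), W; rewrite big_cons /= perm_cons.
Qed.

Lemma seqmul_eq1 s : all (mem G) s -> zero_sum (@xy p) s ->
  cz (seqmul s) = 0 -> seqmul s = 1%g.
Proof.
move=> sG zs z0; have := central_seqmul sG; rewrite zs => /andP[/eqP x0 /eqP y0].
by apply: UT3_coord_inj; rewrite ?seqmul_in ?group1 // ?cx1 ?cy1 ?cz1.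
Qed.

Lemma prod_one_cat_central N V c : all (mem G) (N ++ V) -> all (@central p) V ->
  zero_sum (@xy p) N -> c \in products N -> \sum_(g <- V) cz g = - c ->
  prod_one (N ++ V).
Proof.
rewrite all_cat => /andP[NG VG] Vc zN /productsP[t tN tc] Vsum.
have tG : all (mem G) t by rewrite (perm_all _ tN).
exists (t ++ V); first by rewrite perm_cat2r.
apply: seqmul_eq1; first by rewrite all_cat tG.
  apply/zero_sumP => k; rewrite big_cat (perm_big _ tN) /= (zero_sumP _ _ zN) add0r.
  by rewrite big1_seq // => g /andP[_ /(allP Vc)/andP[/eqP gx /eqP gy]]; case: k.
have VC : ~~ noncommuting V.
  apply/negP => /noncommutingP[g [h [_ hV]]].
  by rewrite omega_central ?eqxx //; apply: (allP Vc).
rewrite /seqmul big_cat /= czM ?seqmul_in // -/(seqmul t) -/(seqmul V).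
rewrite tc cz_seqmul_commuting // Vsum omega_seqmul // big1_seq; first by ring.
by move=> h /andP[_ hV]; apply: omega_central; apply: (allP Vc).
Qed.

Lemma zero_sum_filter T :
  zero_sum (@xy p) T -> zero_sum (@xy p) (filter (predC (@central p)) T).
Proof.
move=> /zero_sumP T0; apply/zero_sumP => k; rewrite -[RHS](T0 k) big_filter.
rewrite [RHS](bigID (@central p)) /= [X in _ = X + _]big1 ?add0r //.
by move=> g /andP[/eqP gx /eqP gy]; case: k.
Qed.

Lemma noncommuting_filter T :
  noncommuting T -> noncommuting (filter (predC (@central p)) T).
Proof.
move=> /noncommutingP[g [h [gT hT nz]]]; apply/noncommutingP; exists g, h.
rewrite !mem_filter /= gT hT !andbT; split=> //.
  by apply: contraNN nz => cg; rewrite omegaC omega_central ?oppr0.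
by apply: contraNN nz => cg; rewrite omega_central.
Qed.

(** A pigeonhole argument in the centre: the ordered products of the noncentral
    terms and the subsequence sums of the central ones are together more than
    [p] values, so one of the former is opposite to one of the latter. *)
Lemma prod_one_sub_of_long T : all (mem G) T -> noncommuting T ->
  zero_sum (@xy p) T -> 1%g \notin T -> (p < size T)%N ->
  exists V W, [/\ perm_eq (V ++ W) T, V != [::] & prod_one V].
Proof.
move=> TG ncT zT T1 ltpT.
set N := filter (predC (@central p)) T; set Z := filter (@central p) T.
have TNZ : perm_eq (N ++ Z) T by rewrite perm_catC; apply/permPl/perm_filterC.
have := perm_all (mem G) TNZ; rewrite TG all_cat => /andP[NG ZG].
have Zc : all (@central p) Z by apply: filter_all.
have zN : zero_sum (@xy p) N by apply: zero_sum_filter.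
have ncN : noncommuting N by apply: noncommuting_filter.
have leN := products_zero_sum NG (filter_all _ _) ncN zN.
have Znz : all (fun g => cz g != 0) Z.
  apply/allP => g; rewrite mem_filter => /andP[/andP[/eqP gx /eqP gy] gT].
  apply: contraNneq T1 => gz; have gG : g \in G by apply: (allP TG).
  by suff <- : g = 1%g; last apply: UT3_coord_inj; rewrite ?cx1 ?cy1 ?cz1 ?group1.
have [X leX XP] := card_sums Znz.
have [c cN cX] : exists2 c, c \in products N & - c \in X.
  suff /subsetPn[c cN] : ~~ (products N \subset [set - d | d in ~: X]).
    move=> cX; exists c => //; apply: contraNT cX => cX.
    by rewrite -[c]opprK imset_f // inE.
  apply/negP => /subset_leq_card; rewrite leqNgt card_imset; last exact: oppr_inj.
  have := cardsC X; rewrite card_Fp // => cX; case/negP.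
  have := perm_size TNZ; rewrite size_cat => szT.
  have arith (q n z m P x y : nat) : (q < m -> 0 < P -> minn q n.-1 <= P ->
    minn q z.+1 <= x -> n + z = m -> x + y = q -> y < P)%N by clear; lia.
  exact: arith ltpT (products_gt0 N) leN leX szT cX.
have [V [W [VW Vsum]]] := XP _ cX.
exists (N ++ V), W; split.
- by rewrite -catA -(permPr TNZ) perm_cat2l.
- by case: N ncN {cN zN leN NG TNZ}.
apply: prod_one_cat_central cN Vsum => //.
  by have := perm_all (mem G) VW; rewrite ZG !all_cat NG => /andP[-> _].
by have := perm_all (@central p) VW; rewrite Zc !all_cat => /andP[-> _].
Qed.

(** The orderings of the noncentral terms already reach every value, so the
    central terms may all be kept. *)
Lemma prod_one_of_many_noncentral T : all (mem G) T -> noncommuting T ->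
  zero_sum (@xy p) T -> (p < count (predC (@central p)) T)%N -> prod_one T.
Proof.
move=> TG ncT zT ltpT.
set N := filter (predC (@central p)) T; set Z := filter (@central p) T.
have TNZ : perm_eq (N ++ Z) T by rewrite perm_catC; apply/permPl/perm_filterC.
have := perm_all (mem G) TNZ; rewrite TG => NZG.
have NG : all (mem G) N by move: NZG; rewrite all_cat => /andP[].
have zN : zero_sum (@xy p) N by apply: zero_sum_filter.
have ncN : noncommuting N by apply: noncommuting_filter.
have leN := products_zero_sum NG (filter_all _ _) ncN zN.
have NT : products N = setT.
  apply/eqP; rewrite eqEcard subsetT cardsT card_Fp //.
  apply: leq_trans leN; rewrite leq_min leqnn /= size_filter.
  by rewrite -ltnS prednK // (leq_trans _ ltpT).
have [t tNZ t1] : prod_one (N ++ Z).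
  apply: (@prod_one_cat_central _ _ (- \sum_(g <- Z) cz g)); rewrite ?NT ?opprK ?in_setT //.
  exact: filter_all.
by exists t => //; apply: perm_trans TNZ.
Qed.

End Noncommuting.

(** * Sequences without product-one subsequences have at most [3 * p.-1] terms *)

Section DavenportBound.

Local Open Scope ring_scope.

Variable p : nat.
Hypotheses (p_pr : prime p) (p_odd : odd p).
Local Notation G := (UT3_group p).
Implicit Types (g h x y z u : {'GL_3(p)}) (c d : 'F_p) (s t S T U V W : seq {'GL_3(p)}).

Lemma zero_sum_xyz T :
  zero_sum (@xyz p) T -> zero_sum (@xy p) T /\ \sum_(g <- T) cz g = 0.
Proof.
by move=> /zero_sumP T0; split; [apply/zero_sumP => k; apply: (T0 (Some k)) | apply: (T0 None)].
Qed.

Lemma prod_one_commuting T : all (mem G) T -> ~~ noncommuting T ->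
  zero_sum (@xyz p) T -> prod_one T.
Proof.
move=> TG cT /zero_sum_xyz[zT z0]; exists T => //; apply: (seqmul_eq1 p_pr p_odd) => //.
by rewrite cz_seqmul_commuting.
Qed.

Definition same_xy x u := [forall k, xy k u == xy k x].

Lemma same_xyP x u : reflect (cx u = cx x /\ cy u = cy x) (same_xy x u).
Proof.
apply: (iffP 'forall_eqP) => [s | [sx sy] [] //].
by split; [apply: (s true) | apply: (s false)].
Qed.

(** Replacing [x] in [T] by a part [V] of [U] with the same sum keeps [T] zero-sum
    and noncommuting, so the maximality of [T] forces [V] to be a single term,
    and [count_same_coord] applies. *)
Lemma exchange_count T U x :
    all (mem G) T -> zero_sum (@xy p) T -> noncommuting T -> x \in T ->
    ~~ central x -> (p.-1 * 2 <= size U)%N ->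
    (forall V W, perm_eq (V ++ W) U -> zero_sum (@xy p) V -> V = [::]) ->
    (forall T' U', perm_eq (T' ++ U') (T ++ U) -> zero_sum (@xy p) T' ->
      noncommuting T' -> (size T' <= size T)%N) ->
  (p %| (count (same_xy x) U).+1)%N.
Proof.
move=> TG zT ncT xT nx leU U0 maxT.
pose x' : {'GL_3(p)} := UT3_elt (- cx x) (- cy x) 0.
have x'E k : xy k x' = - xy k x.
  by have [x'x x'y _] := UT3_elt_coord (- cx x) (- cy x) 0; case: k.
apply: (@count_same_coord p _ _ (@xy p) p_pr x x') => [||//|V W VW zV].
- exact: x'E.
- by rewrite card_bool.
have TT' := perm_to_rem xT; set T' := rem x T in TT'.
rewrite (perm_zero_sum (@xy p) TT') in zT.
have ncT' : noncommuting T'.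
  by apply: noncommuting_behead zT _; rewrite -(perm_noncommuting TT').
have : (size (T' ++ V) <= size T)%N.
  apply: (maxT _ (x :: W)).
  - apply/seq.permP => a; have := seq.permP TT' a; have := seq.permP VW a.
    by rewrite !count_cat /= => <- ->; ring.
  - apply/zero_sumP => k; rewrite big_cat /=.
    have := zero_sumP _ _ zT k; have := zero_sumP _ _ zV k.
    rewrite !big_cons x'E => V0 T0; rewrite -[RHS](addr0 0) -[X in _ = X + _]T0.
    by rewrite -[X in _ = _ + X]V0; ring.
  case/noncommutingP: ncT' => g [h [gT hT nz]]; apply/noncommutingP.
  by exists g, h; rewrite !mem_cat gT hT.
rewrite (perm_size TT') size_cat /= -[X in (_ <= X)%N]addn1 leq_add2l => leV1.
apply/eqP; rewrite eqn_leq leV1 lt0n size_eq0; apply: contraNneq nx => V0.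
have := zero_sumP _ _ zV; rewrite V0 => xV0.
apply/andP; split; rewrite -oppr_eq0.
  by have := xV0 true; rewrite big_seq1 x'E => ->.
by have := xV0 false; rewrite big_seq1 x'E => ->.
Qed.

(** A longest noncommuting zero-sum part [T] and its complement [U] must have
    exactly [p] and [2 * p.-1] terms; by [exchange_count] the vectors of two
    noncommuting terms [x] and [y] of [T] then exhaust [U], hence also the
    noncentral part of [T], and the sum of the [omega z y] over the terms [z]
    of [T] is contradictory. *)
Lemma prod_one_exists S : all (mem G) S -> (3 * p.-1 < size S)%N ->
  exists V W, [/\ perm_eq (V ++ W) S, V != [::] & prod_one V].
Proof.
move=> SG ltS; apply: contrapT => noV.
have sub_G V W : perm_eq (V ++ W) S -> all (mem G) V /\ all (mem G) W.
  by move/(perm_all (mem G)); rewrite SG all_cat => /andP[].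
have S1 : 1%g \notin S.
  apply/negP => /perm_to_rem S1; apply: noV; exists [:: 1%g], (rem 1%g S).
  by rewrite perm_sym; split=> //; exists [:: 1%g]; rewrite ?/seqmul ?big_seq1.
pose long m := `[< exists T U, [/\ perm_eq (T ++ U) S, zero_sum (@xy p) T,
  noncommuting T & size T = m] >].
have [|m|m /asboolP[T [U [TU zT ncT szT]]] maxT] := @ex_maxnP long (size S).
- have [|T [U [TU nT zT]]] := @zero_sum_exists p _ _ (@xyz p) p_pr S.
    by rewrite card_option card_bool mulnC.
  exists (size T); apply/asboolP; exists T, U; split=> //; first by case/zero_sum_xyz: zT.
  apply: contraT => cT; case: noV; exists T, U; split=> //.
  by apply: prod_one_commuting => //; case: (sub_G T U).
- by move=> /asboolP[T [U [/perm_size <- _ _ <-]]]; rewrite size_cat leq_addr.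
have [TG UG] := sub_G _ _ TU.
have {}maxT T' U' : perm_eq (T' ++ U') (T ++ U) -> zero_sum (@xy p) T' ->
    noncommuting T' -> (size T' <= size T)%N.
  move=> TU' zT' ncT'; rewrite szT; apply: maxT; apply/asboolP.
  by exists T', U'; split=> //; apply: perm_trans TU' TU.
have U0 V W : perm_eq (V ++ W) U -> zero_sum (@xy p) V -> V = [::].
  move=> VW zV; have := maxT (T ++ V) W; rewrite -catA perm_cat2l VW.
  move=> /(_ isT (zero_sum_cat zT zV)); rewrite size_cat -[X in (_ <= X)%N]addn0 leq_add2l.
  rewrite leqn0 size_eq0 => V0; apply/eqP/V0.
  case/noncommutingP: ncT => g [h [gT hT nz]]; apply/noncommutingP.
  by exists g, h; rewrite !mem_cat gT hT.
have leU : (size U <= p.-1 * 2)%N.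
  rewrite leqNgt; apply/negP => ltU.
  have [|V [W [VW nV zV]]] := @zero_sum_exists p _ _ (@xy p) p_pr U.
    by rewrite card_bool.
  by rewrite (U0 _ _ VW zV) in nV.
have leT : (size T <= p)%N.
  rewrite leqNgt; apply/negP => ltT; apply: noV.
  have T1 : 1%g \notin T.
    by apply: contraNN S1 => T1; rewrite -(perm_mem TU) mem_cat T1.
  have [V [W [VW nV V1]]] := prod_one_sub_of_long p_pr p_odd TG ncT zT T1 ltT.
  exists V, (W ++ U); split=> //; apply: perm_trans TU.
  by rewrite catA perm_cat2r.
have [eqT eqU] : (size T = p /\ size U = p.-1 * 2)%N.
  have arith (q a b n : nat) : (0 < q -> 3 * q.-1 < n -> a <= q -> b <= q.-1 * 2 ->
    a + b = n -> a = q /\ b = q.-1 * 2)%N by clear; lia.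
  by apply: arith ltS leT leU _; rewrite ?prime_gt0 // -size_cat (perm_size TU).
have count_ge z : z \in T -> ~~ central z -> (p.-1 <= count (same_xy z) U)%N.
  move=> zT' nz; have := exchange_count TG zT ncT zT' nz _ U0 maxT.
  rewrite eqU => /(_ (leqnn _)) /dvdn_leq - /(_ isT).
  by rewrite -[X in (X <= _)%N](prednK (prime_gt0 p_pr)).
have /noncommutingP[x [y [xT yT nz]]] := ncT.
have nx : ~~ central x.
  by apply: contraNN nz => cx; rewrite omegaC omega_central ?oppr0.
have ny : ~~ central y by apply: contraNN nz => cy; rewrite omega_central.
have U_xy u : u \in U -> same_xy x u || same_xy y u.
  have : all (predU (same_xy x) (same_xy y)) U.
    rewrite all_count eqn_leq count_size /=.
    have := count_predUI (same_xy x) (same_xy y) U.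
    rewrite [count (predI _ _) _](@eq_count _ _ pred0) ?count_pred0 ?addn0 => [->|v].
      by rewrite eqU muln2 -addnn leq_add ?count_ge.
    apply/negP => /andP[/same_xyP[vx vy] /same_xyP[vx' vy']].
    by case/eqP: nz; rewrite /omega -vx -vy -vx' -vy' subrr.
  by move/allP; apply.
have omega_y z : z \in T -> omega z y = if same_xy x z then omega x y else 0.
  move=> zT'; case: (same_xyP x z) => [[zx zy] | nzx]; first by rewrite /omega zx zy.
  have [cz | nz'] := boolP (central z); first by rewrite omegaC omega_central ?oppr0.
  have /hasP[u uU /same_xyP[uz1 uz2]] : has (same_xy z) U.
    by rewrite has_count (leq_trans _ (count_ge z zT' nz')) // -ltnS prednK ?prime_gt0 ?prime_gt1.
  case/orP: (U_xy u uU) => /same_xyP[ux uy].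
    by case: nzx; rewrite -uz1 -uz2.
  by rewrite /omega -uz1 -uz2 ux uy subrr.
have : (p %| count (same_xy x) T)%N.
  rewrite (dvdn_pcharf (pchar_Fp p_pr)) -(inj_eq (mulfI nz)) mulr0 mulr_natr.
  rewrite -[X in X == _](_ : \sum_(z <- T) omega z y = _).
    rewrite -oppr_eq0 -sumrN; apply/eqP; rewrite -[RHS](omega_zero_sum y zT).
    by apply: eq_bigr => z _; rewrite -omegaC.
  rewrite big_seq (eq_bigr _ omega_y) -big_seq -big_mkcond big_const_seq.
  by rewrite iter_addr_0.
move/dvdn_leq; rewrite -has_count.
have -> : has (same_xy x) T by apply/hasP; exists x => //; apply/same_xyP.
move/(_ isT); rewrite leqNgt -[X in (_ < X)%N]eqT -(count_predC (same_xy x) T).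
rewrite -[X in (X < _)%N]addn0 ltn_add2l -has_count => /negP; apply; apply/hasP.
exists y => //=; apply: contraNN nz => /same_xyP[yx yy].
by rewrite /omega yx yy subrr.
Qed.

End DavenportBound.

(** * Product-one subsequences of length [p ^ 3] *)

Section GaoBound.

Local Open Scope ring_scope.

Variable p : nat.
Hypotheses (p_pr : prime p) (p_odd : odd p).
Local Notation G := (UT3_group p).
Implicit Types (g h x y z u : {'GL_3(p)}) (c d : 'F_p) (s t S T U V W : seq {'GL_3(p)}).

Lemma central_commute g h : g \in G -> h \in G -> central g -> commute g h.
Proof.
move=> gG hG cg.
apply: (UT3_coord_inj p_pr p_odd (UT3M gG hG) (UT3M hG gG)).
- by rewrite !cxM // addrC.
- by rewrite !cyM // addrC.
by rewrite !czM // (omegaC g) omega_central // oppr0 !addr0 addrC.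
Qed.

(** There are only [p] central elements, and [p ^ 3 - p] is more than [p] times [3
    * p.-1 - 1]. *)
Lemma central_frequent T : all (mem G) T -> (p ^ 3 <= size T)%N ->
    (count (predC (@central p)) T <= p)%N ->
  exists g, [/\ g \in T, central g & (3 * p.-1 <= count_mem g T)%N].
Proof.
move=> TG leT leN; have p1 : (0 < 3 * p.-1)%N.
  by rewrite muln_gt0 /= -ltnS prednK ?prime_gt0 ?prime_gt1.
have cz_count : (count (@central p) T =
    \sum_(c : 'F_p) count (fun g => central g && (cz g == c)) T)%N.
  elim: (T) => [|g s IHs] /=; first by rewrite big1.
  rewrite big_split /= -IHs; congr (_ + _)%N.
  rewrite (bigD1 (cz g)) //= eqxx andbT big1 ?addn0 // => c /negPf.
  by rewrite eq_sym => ->; rewrite andbF.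
have [c lec] : exists c, (3 * p.-1 <= count (fun g => central g && (cz g == c)) T)%N.
  apply: contrapT => noc.
  have: (count (@central p) T <= \sum_(c : 'F_p) (3 * p.-1).-1)%N.
    rewrite cz_count; apply: leq_sum => c _; rewrite -ltnS prednK //.
    by rewrite ltnNge; apply/negP => lec; apply: noc; exists c.
  rewrite sum_nat_const card_Fp // leqNgt => /negP; apply.
  have arith (q a b n : nat) : (2 < q -> a + b = n -> q ^ 3 <= n -> b <= q ->
      q * (3 * q.-1).-1 < a)%N.
    by clear; rewrite !expnS expn0; nia.
  exact: arith (odd_prime_gt2 p_odd p_pr) (count_predC _ _) leT leN.
have /hasP[g gT /andP[cg /eqP gc]] : has (fun g => central g && (cz g == c)) T.
  by rewrite has_count (leq_trans _ lec).
exists g; split=> //; apply: leq_trans lec _.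
rewrite [leqLHS](@eq_in_count _ _ [pred h in T | central h && (cz h == c)]) => [|h hT].
  apply: sub_count => h /= /andP[hT /andP[/andP[/eqP hx /eqP hy] /eqP hc]]; apply/eqP.
  case/andP: cg => /eqP gx /eqP gy.
  apply: (UT3_coord_inj p_pr p_odd (allP TG _ hT) (allP TG _ gT)); congruence.
by rewrite /= hT.
Qed.

(** The abelian theorem gives a part of length [p ^ 3] with vanishing coordinates;
    it can fail to be product-one only if few of its terms are noncentral, and
    then a central element is frequent. *)
Lemma prod_one_gao S : all (mem G) S -> size S = (p ^ 3 + 3 * p.-1)%N ->
  exists V W, [/\ perm_eq (V ++ W) S, prod_one V & size V = (p ^ 3)%N].
Proof.
move=> SG szS.
have p3 := odd_prime_gt2 p_odd p_pr.
have [|T [U [TU nT zT p3T]]] := @zero_sum_exists_length p _ _ (@xyz p) p_pr S 3.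
  by rewrite card_option card_bool szS addnC mulnC ltn_add2r prednK // expn_gt0 prime_gt0.
have szT : size T = (p ^ 3)%N.
  have szTU : (size T + size U)%N = (p ^ 3 + 3 * p.-1)%N by rewrite -szS -(perm_size TU) size_cat.
  have ltS : (3 * p.-1 < p ^ 3)%N.
    have arith (q : nat) : (2 < q -> 3 * q.-1 < q ^ 3)%N.
      by clear; rewrite !expnS expn0; nia.
    exact: arith.
  have T_gt0 : (0 < size T)%N by rewrite lt0n size_eq0.
  move/dvdnP: p3T => [k kE].
  have arith (q d k' v w : nat) : (0 < v -> v = k' * q -> v + w = q + d -> d < q -> v = q)%N.
    by clear; case: k' => [|[|k']]; nia.
  exact: arith T_gt0 kE szTU ltS.
have TG : all (mem G) T.
  by have := perm_all (mem G) TU; rewrite SG all_cat => /andP[].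
have [ncT | cT] := boolP (noncommuting T); last first.
  by exists T, U; split=> //; apply: prod_one_commuting.
have [leN | ltN] := leqP (count (predC (@central p)) T) p; last first.
  exists T, U; split=> //; apply: prod_one_of_many_noncentral => //.
  by case/zero_sum_xyz: zT.
have [|g [gT cg leg]] := central_frequent TG _ leN; first by rewrite szT.
have [||||V [W [VW V1 szV]]] := prod_one_central_frequent
  (prod_one_exists p_pr p_odd) (S := S) (g := g) SG.
- by rewrite card_UT3.
- by rewrite -(perm_mem TU) mem_cat gT.
- by move=> h hG; apply: central_commute cg => //; apply: (allP TG).
- by rewrite -(seq.permP TU) count_cat (leq_trans leg) ?leq_addr.
by exists V, W; rewrite szV card_UT3.
Qed.

End GaoBound.

(** * An extremal sequence *)

Section Extremal.

Local Open Scope ring_scope.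

Variable p : nat.
Hypotheses (p_pr : prime p) (p_odd : odd p).
Local Notation G := (UT3_group p).
Implicit Types (g h : {'GL_3(p)}) (s t T V W : seq {'GL_3(p)}).

Definition gen_x : {'GL_3(p)} := UT3_elt 1 0 0.
Definition gen_y : {'GL_3(p)} := UT3_elt 0 1 0.
Definition gen_z : {'GL_3(p)} := UT3_elt 0 0 1.

Definition free_seq : seq {'GL_3(p)} :=
  nseq p.-1 gen_x ++ nseq p.-1 gen_y ++ nseq p.-1 gen_z.

Lemma size_free_seq : size free_seq = (3 * p.-1)%N.
Proof. by rewrite !size_cat !size_nseq; ring. Qed.

Lemma free_seq_in : all (mem G) free_seq.
Proof. by rewrite !all_cat !all_nseq /= !UT3_elt_in !orbT. Qed.

Lemma mem_free_seq g : g \in free_seq -> [\/ g = gen_x, g = gen_y | g = gen_z].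
Proof.
rewrite !mem_cat !mem_nseq => /or3P[] /andP[_ /eqP ->];
by [apply: Or31 | apply: Or32 | apply: Or33].
Qed.

(** Here [c *+ count_mem g T] is the sum of the values of [w], and a number of
    copies between [1] and [p.-1] is invertible modulo [p]. *)
Lemma count_coord0 (w : {'GL_3(p)} -> 'F_p) (c : 'F_p) g T : c != 0 ->
    {in T, forall h, w h = if h == g then c else 0} ->
    \sum_(h <- T) w h = 0 -> (count_mem g T < p)%N -> g \notin T.
Proof.
move=> nz_c wE; rewrite big_seq (eq_bigr _ wE) -big_seq -big_mkcond big_const_seq.
rewrite iter_addr_0 => /eqP; rewrite -mulr_natr mulf_eq0 (negPf nz_c) /=.
rewrite -(dvdn_pcharf (pchar_Fp p_pr)) => pc ltc; apply/negP => gT.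
by move: ltc; rewrite ltnNge dvdn_leq // -has_count has_pred1.
Qed.

(** The coordinates [cx] and [cy] of the product exclude [gen_x] and [gen_y]; the
    remaining terms commute, and then [cz] excludes [gen_z]. *)
Lemma prod_one_gens T : prod_one T ->
    {in T, forall g, g = 1%g \/ g \in free_seq} ->
    {in free_seq, forall g, count_mem g T < p}%N ->
  {in T, forall g, g = 1%g}.
Proof.
move=> [t tT t1] Tgens Tcount.
have p1 : (0 < p.-1)%N by rewrite -ltnS prednK ?prime_gt0 ?prime_gt1.
have [xx xy xz] := UT3_elt_coord (1 : 'F_p) 0 0.
have [yx yy yz] := UT3_elt_coord (0 : 'F_p) 1 0.
have [zx zy zz] := UT3_elt_coord (0 : 'F_p) 0 1.
have two0 := two_neq0 p_pr p_odd.
have Tg g : g \in T -> [\/ g = 1%g, g = gen_x, g = gen_y | g = gen_z].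
  case/Tgens => [->|/mem_free_seq[]->]; [exact: Or41|exact: Or42|exact: Or43|exact: Or44].
have TG : all (mem G) T.
  by apply/allP => g /Tg[]->; rewrite /= ?group1 ?UT3_elt_in.
have tG : all (mem G) t by rewrite (perm_all _ tT).
have xT : gen_x \notin T.
  apply: (@count_coord0 (@cx p) 1).
  - exact: oner_neq0.
  - by move=> h /Tg[]->; rewrite ?cx1 ?xx ?yx ?zx; case: eqP => // /(congr1 (@cx p));
      rewrite ?cx1 xx ?yx ?zx.
  - by rewrite -(perm_big _ tT) -cx_seqmul // t1 cx1.
  by apply: Tcount; rewrite !mem_cat !mem_nseq p1 eqxx.
have yT : gen_y \notin T.
  apply: (@count_coord0 (@cy p) 1).
  - exact: oner_neq0.
  - by move=> h /Tg[]->; rewrite ?cy1 ?xy ?yy ?zy; case: eqP => // /(congr1 (@cy p));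
      rewrite ?cy1 yy ?xy ?zy.
  - by rewrite -(perm_big _ tT) -cy_seqmul // t1 cy1.
  by apply: Tcount; rewrite !mem_cat !mem_nseq p1 eqxx orbT.
have {}Tg g : g \in T -> g = 1%g \/ g = gen_z.
  move=> gT; case: (Tg g gT) => gE; [by left | | | by right].
    by rewrite -gE gT in xT.
  by rewrite -gE gT in yT.
have zT : gen_z \notin T.
  apply: (@count_coord0 (@cz p) 2) => //.
  - by move=> h /Tg[]->; rewrite ?cz1 ?zz ?mul0r ?subr0; case: eqP => // /(congr1 (@cz p));
      rewrite cz1 zz mul0r subr0 => /esym/eqP; rewrite (negPf two0).
  - rewrite -(perm_big _ tT) -cz_seqmul_commuting ?t1 ?cz1 //.
    apply/negP => /noncommutingP[g [h [_ ]]]; rewrite (perm_mem tT) => /Tg hE.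
    by rewrite omega_central ?eqxx // /central; case: hE => ->; rewrite ?cx1 ?cy1 ?zx ?zy eqxx.
  by apply: Tcount; rewrite !mem_cat !mem_nseq p1 eqxx !orbT.
by move=> g gT; case: (Tg g gT) => // gE; rewrite -gE gT in zT.
Qed.

Lemma count_free_seq g : g \in free_seq -> count_mem g free_seq = p.-1 /\ g != 1%g.
Proof.
have [xx xy xz] := UT3_elt_coord (1 : 'F_p) 0 0.
have [yx yy yz] := UT3_elt_coord (0 : 'F_p) 1 0.
have [zx zy zz] := UT3_elt_coord (0 : 'F_p) 0 1.
have two0 := two_neq0 p_pr p_odd; have one0 := oner_neq0 'F_p.
have xy_n : (gen_x == gen_y) = false.
  by apply: contraNF one0 => /eqP/(congr1 (@cx p)); rewrite xx yx => ->.
have xz_n : (gen_x == gen_z) = false.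
  by apply: contraNF one0 => /eqP/(congr1 (@cx p)); rewrite xx zx => ->.
have yz_n : (gen_y == gen_z) = false.
  by apply: contraNF one0 => /eqP/(congr1 (@cy p)); rewrite yy zy => ->.
case/mem_free_seq=> ->; rewrite !count_cat !count_nseq /= !eqxx ?xy_n ?xz_n ?yz_n
  ?(eq_sym gen_y gen_x) ?(eq_sym gen_z gen_x) ?(eq_sym gen_z gen_y) ?xy_n ?xz_n ?yz_n;
  rewrite ?mul0n ?mul1n ?addn0; split=> //.
- by apply: contraNneq one0 => /(congr1 (@cx p)); rewrite xx cx1 => ->.
- by apply: contraNneq one0 => /(congr1 (@cy p)); rewrite yy cy1 => ->.
apply: contraNneq two0 => /(congr1 (@cz p)).
by rewrite zz cz1 mul0r subr0 => ->.
Qed.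

End Extremal.

(** * The two constants *)

Section Multisets.

Variable p : nat.
Local Notation G := (UT3_group p).
Implicit Types (S T : {mset {'GL_3(p)}}%mset) (V W : seq {'GL_3(p)}).

Lemma msubset_perm S T : (T `<=` S)%mset <->
  exists W, perm_eq (enum_mset T ++ W) (enum_mset S).
Proof.
split=> [/msubsetP TS | [W TW]].
  exists (enum_mset (S `\` T)%mset); apply/allP => x _ /=.
  by rewrite count_cat !count_mem_mset msetE2 subnKC.
apply/msubsetP => x; rewrite -!count_mem_mset -(seq.permP TW) count_cat.
exact: leq_addr.
Qed.

Lemma product_one_seq_mset V : V != [::] -> prod_one V -> product_one (seq_mset V).
Proof.
move=> nV [t tV t1]; split; last first.
  by exists t => //; apply: perm_trans tV _; rewrite perm_sym perm_eq_seq_mset.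
move=> V0; have := perm_size (perm_eq_seq_mset V).
by rewrite V0 enum_mset0 => /esym/eqP; rewrite size_eq0 (negPf nV).
Qed.

Lemma seq_mset_subset S V W :
  perm_eq (V ++ W) (enum_mset S) -> (seq_mset V `<=` S)%mset.
Proof.
move=> VW; apply/msubset_perm; exists W; apply: perm_trans VW.
by rewrite perm_cat2r perm_eq_seq_mset.
Qed.

Hypotheses (p_pr : prime p) (p_odd : odd p).

Lemma product_one_free_free_seq :
  product_one_free (seq_mset (free_seq p)).
Proof.
move=> T TS [T0 [t tT t1]].
have [W] := (msubset_perm _ _).1 TS; rewrite (permPr (perm_eq_seq_mset _)) => TW.
have Tfree g : g \in enum_mset T -> g \in free_seq p.
  by move=> gT; rewrite -(perm_mem TW) mem_cat gT.
have T1 : {in enum_mset T, forall g, g = 1%g}.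
  apply: (prod_one_gens p_pr p_odd (ex_intro2 _ _ t tT t1)).
    by move=> g /Tfree; right.
  move=> g gF; have [cg _] := count_free_seq p_pr p_odd gF.
  rewrite -[X in (_ < X)%N](prednK (prime_gt0 p_pr)) ltnS -cg -(seq.permP TW).
  by rewrite count_cat leq_addr.
case ET : (enum_mset T) => [|g r].
  by apply: T0; apply/msetP => x; rewrite -!count_mem_mset ET enum_mset0.
have gT : g \in enum_mset T by rewrite ET mem_head.
by have [_] := count_free_seq p_pr p_odd (Tfree g gT); rewrite (T1 g gT) eqxx.
Qed.

Lemma small_davenport_UT3 : small_davenport G = 3 * p.-1.
Proof.
rewrite /small_davenport; case: ex_maxnP => d /asboolP[S [SG <- Sfree]] maxd.
apply/eqP; rewrite eqn_leq; apply/andP; split.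
  rewrite leqNgt; apply/negP => ltS.
  have [|V [W [VW nV V1]]] := prod_one_exists p_pr p_odd _ ltS.
    by apply/allP => g; apply: SG.
  by apply: (Sfree (seq_mset V)); [apply: seq_mset_subset VW | apply: product_one_seq_mset].
apply: maxd; apply/asboolP; exists (seq_mset (free_seq p)); split.
- move=> g; rewrite (perm_mem (perm_eq_seq_mset _)).
  exact: (allP (free_seq_in p)).
- by rewrite (perm_size (perm_eq_seq_mset _)) size_free_seq.
exact: product_one_free_free_seq.
Qed.

Lemma gao_property_UT3 : gao_property G (p ^ 3 + 3 * p.-1).
Proof.
move=> S SG leS; pose s := take (p ^ 3 + 3 * p.-1) (enum_mset S).
have [||V [W [VW V1 szV]]] := @prod_one_gao p p_pr p_odd s.
- by apply/allP => g /mem_take; apply: SG.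
- by rewrite size_takel.
have nV : V != [::] by rewrite -size_eq0 szV -lt0n expn_gt0 prime_gt0.
exists (seq_mset V); split.
- apply: (@seq_mset_subset _ _ (W ++ drop (p ^ 3 + 3 * p.-1) (enum_mset S))).
  by rewrite catA -[X in perm_eq _ X](cat_take_drop (p ^ 3 + 3 * p.-1)) perm_cat2r.
- exact: product_one_seq_mset.
by rewrite (perm_size (perm_eq_seq_mset _)) szV card_UT3.
Qed.

(** A product-one subsequence of [p ^ 3 - 1] identities and [free_seq] consists of
    identities only, so it is too short. *)
Lemma gao_property_UT3_ge l : gao_property G l -> p ^ 3 + 3 * p.-1 <= l.
Proof.
move=> Gl; rewrite leqNgt; apply/negP => ltl.
have q_gt0 : 0 < p ^ 3 by rewrite expn_gt0 prime_gt0.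
pose s := nseq (p ^ 3).-1 1%g ++ free_seq p.
have [||T [TS [T0 [t tT t1]] szT]] := Gl (seq_mset s).
- move=> g; rewrite (perm_mem (perm_eq_seq_mset _)) mem_cat mem_nseq.
  by case/orP => [/andP[_ /eqP ->]|/(allP (free_seq_in p))]; rewrite ?group1.
- rewrite (perm_size (perm_eq_seq_mset _)) size_cat size_nseq size_free_seq.
  by rewrite -ltnS -addSn prednK.
have [W] := (msubset_perm _ _).1 TS; rewrite (permPr (perm_eq_seq_mset _)) => TW.
have F1 : count_mem 1%g (free_seq p) = 0.
  apply/count_memPn/negP => /(count_free_seq p_pr p_odd)[_]; by rewrite eqxx.
have T1 : {in enum_mset T, forall g, g = 1%g}.
  apply: (prod_one_gens p_pr p_odd (ex_intro2 _ _ t tT t1)).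
    move=> g gT; have : g \in s by rewrite -(perm_mem TW) mem_cat gT.
    by rewrite mem_cat mem_nseq => /orP[/andP[_ /eqP]|]; [left | right].
  move=> g gF; have [cg ng1] := count_free_seq p_pr p_odd gF.
  have cs : count_mem g s = p.-1.
    by rewrite count_cat count_nseq /= eq_sym (negPf ng1) mul0n.
  rewrite -[X in (_ < X)%N](prednK (prime_gt0 p_pr)) ltnS -cs -(seq.permP TW).
  by rewrite count_cat leq_addr.
have : count_mem 1%g (enum_mset T) <= (p ^ 3).-1.
  have -> : (p ^ 3).-1 = count_mem 1%g s.
    by rewrite count_cat count_nseq /= eqxx mul1n F1 addn0.
  by rewrite -(seq.permP TW) count_cat leq_addr.
have /all_pred1P -> : all (pred1 1%g) (enum_mset T).
  by apply/allP => g /T1 ->; apply: eqxx.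
by rewrite count_nseq /= eqxx mul1n szT card_UT3 // leqNgt prednK // leqnn.
Qed.

End Multisets.

Theorem theorem1p1 (p : nat) (p_prime : prime p) (p_odd : odd p) :
  let G := UT3_group p in
  gao G = small_davenport G + #|G| /\
  small_davenport G + #|G| = p ^ 3 + 3 * p - 3.
Proof.
move=> G; rewrite small_davenport_UT3 // card_UT3 //.
have eqN : 3 * p.-1 + p ^ 3 = p ^ 3 + 3 * p - 3.
  by rewrite -subn1 mulnBr addnC addnBA // leq_pmulr ?prime_gt0.
split=> //; rewrite /gao; case: ex_minnP => n /asboolP Gn minn.
apply/eqP; rewrite addnC eqn_leq gao_property_UT3_ge // andbT.
by apply: minn; apply/asboolP; apply: gao_property_UT3.
Qed.
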